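(* Let $r_0>0$, $k\ge2$, $m>0$ with $m\ne1$, and let $\overline M=\overline{B_{r_0}(0)}$ be a closed geodesic ball of radius $r_0$ in $(\mathbb{H}^2,g_{-1})$, $g_{-1}=dr^2+\sinh^2(r)d\theta^2$, with interior $M$ and boundary $\partial M$. Let $\xi(t)=1+e^{-2t}(m-1)$ and $\eta(t)=\xi(t)^{-1/2}\frac{\cosh r_0}{\sinh r_0}+\rho(t)$, where $\rho\in C^k([0,\infty))$ satisfies $\rho(0)=\rho^{(j)}(0)=0$ for $1\le j\le k$, $\rho'(t)\ge0$ for $t\ge0$, and $\rho'(t)>0$ for $t\in(0,t_1)$ for some $t_1>0$; if $m>1$ assume also $\rho'(t)\ge(1-\xi(t)^{-1})\rho(t)$ for $t\ge0$. Let $g(t)$, $t\in[0,T)$ with $T$ the maximal existence time, be the solution of $\partial_tg=-2(K_g+1)g$ in $\overline M$, $k_g=\eta$ on $\partial M$, $g(0)=mg_{-1}$. Let $F_1=K_{g(t)}+\xi(t)^{-1}$. Then $F_1\le0$ on $\overline M\times[0,T)$, and $F_1<0$ on $\overline M\times(0,T)$.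
   Context: $K_g$ is the Gaussian curvature of $g$ and $k_g$ the geodesic curvature of $\partial M$ with respect to $g$. The solution is rotationally symmetric, $g(t)=a(r,t)^2dr^2+b(r,t)^2d\theta^2$, and $K_g=-b^{-1}\partial_s^2 b$ with $s$ the $g(t)$-distance to the origin. *)

(* Defs.v *)
From Stdlib Require Import Reals.
From Coquelicot Require Import Coquelicot.
Open Scope R_scope.

Definition xi (m t : R) : R := 1 + exp (-2 * t) * (m - 1).

Definition eta (m r0 : R) (rho : R -> R) (t : R) : R :=
  / sqrt (xi m t) * (cosh r0 / sinh r0) + rho t.

Definition d_r (f : R -> R -> R) (r t : R) : R := Derive (fun x => f x t) r.
Definition d_t (f : R -> R -> R) (r t : R) : R := Derive (fun s => f r s) t.

(* Rotationally symmetric metric g = a^2 dr^2 + b^2 dtheta^2 ;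
   d_s = a^{-1} d_r is the derivative w.r.t. g(t)-arclength s from origin. *)
Definition ds_b (a b : R -> R -> R) (r t : R) : R := d_r b r t / a r t.
Definition dss_b (a b : R -> R -> R) (r t : R) : R :=
  Derive (fun x => ds_b a b x t) r / a r t.

(* Gaussian curvature K_g = - b^{-1} d_s^2 b  (valid for r > 0). *)
Definition gaussK (a b : R -> R -> R) (r t : R) : R := - dss_b a b r t / b r t.

Definition geodK (a b : R -> R -> R) (r0 t : R) : R := ds_b a b r0 t / b r0 t.

Definition jcont (f : R -> R -> R) (r t : R) : Prop :=
  continuous (fun p : R * R => f (fst p) (snd p)) (r, t).

(* Hypotheses on rho in C^k([0,oo)) (rho is given on all of R; its values for
   t < 0 are irrelevant apart from allowing two-sided derivatives at 0). *)
Definition rho_hyp (k : nat) (m : R) (rho : R -> R) : Prop :=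
  (forall j t, (j <= k)%nat -> ex_derive_n rho j t) /\
  (forall t, continuous (Derive_n rho k) t) /\
  rho 0 = 0 /\
  (forall j, (1 <= j <= k)%nat -> Derive_n rho j 0 = 0) /\
  (forall t, 0 <= t -> 0 <= Derive rho t) /\
  (exists t1, 0 < t1 /\ forall t, 0 < t < t1 -> 0 < Derive rho t) /\
  (1 < m -> forall t, 0 <= t -> (1 - / xi m t) * rho t <= Derive rho t).

(* (a,b) on [0,r0] x [0,T) is a rotationally symmetric solution of
     d_t g = -2 (K_g + 1) g  in Mbar,   k_g = eta on dM,   g(0) = m g_{-1},
   with g_{-1} = dr^2 + sinh^2 r dtheta^2.  The functions are given on
   R x (-oo,T) (a smooth solution on the closed domain extends) and the
   equations are imposed on the closed domain. *)
Definition is_sym_solution (m r0 : R) (etaf : R -> R) (T : R)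
  (a b : R -> R -> R) : Prop :=
  (forall r t, t < T ->
     ex_derive (fun x => a x t) r /\ ex_derive (fun x => b x t) r /\
     ex_derive (fun x => ds_b a b x t) r /\
     ex_derive (fun s => a r s) t /\ ex_derive (fun s => b r s) t /\
     jcont a r t /\ jcont b r t /\ jcont (d_r a) r t /\ jcont (d_r b) r t /\
     jcont (fun x s => Derive (fun y => ds_b a b y s) x) r t /\
     jcont (d_t a) r t /\ jcont (d_t b) r t) /\
  (* it is a Riemannian metric, smooth at the origin *)
  (forall r t, 0 <= r <= r0 -> 0 <= t < T -> 0 < a r t) /\
  (forall r t, 0 < r <= r0 -> 0 <= t < T -> 0 < b r t) /\
  (forall t, 0 <= t < T ->
     b 0 t = 0 /\ d_r b 0 t = a 0 t /\ d_r a 0 t = 0 /\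
     exists K0, filterlim (fun r => gaussK a b r t) (at_right 0) (locally K0)) /\
  (forall r t, 0 < r <= r0 -> 0 <= t < T ->
     d_t a r t = - (gaussK a b r t + 1) * a r t /\
     d_t b r t = - (gaussK a b r t + 1) * b r t) /\
  (forall t, 0 <= t < T -> geodK a b r0 t = etaf t) /\
  (forall r, 0 <= r <= r0 -> a r 0 = sqrt m /\ b r 0 = sqrt m * sinh r).

(* Main.v *)
Require Import Defs.
From Stdlib Require Import Reals ZArith Lra Lia Classical.
From Coquelicot Require Import Coquelicot.
Open Scope R_scope.

(* The flow preserves the conformal class, so b = a sinh r, and in the time s with
   ds = dt / xi the function G = log (a / sqrt xi) solves the autonomous equation
   exp (2 G) (G_s + 1) = Delta G + 1, where Delta is the Laplacian of g_{-1}, with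
   G = 0 initially and G_r = coth r0 (e^G - 1) + e^G sigma at r = r0, where
   sigma = sqrt xi * rho.  Since F_1 = - G_s / xi, the claim is that G is strictly
   increasing in time.  The solution is not assumed regular enough to
   differentiate the equation for K, so G is compared with its time translates
   instead: the hypotheses on rho say that sigma is nondecreasing, hence
   V = G(s + h) - G(s) >= 0 by the minimum principle.  Strictness needs lower
   bounds V >= h mu with mu independent of h; they come from a travelling
   exponential barrier while sigma grows, and afterwards from the
   barrier mu exp (- C s). *)

(** * Derivative tests from one-sided information *)

Lemma is_derive_right_sign (f : R -> R) (x l d : R) :
  is_derive f x l -> 0 < d ->
  (forall y, x < y < x + d -> f x <= f y) -> 0 <= l.
Proof.
intros Hf Hd Hm.
apply Rnot_lt_le; intros Hl.
apply is_derive_Reals in Hf.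
destruct (Hf (- l) ltac:(lra)) as [e He].
pose proof (cond_pos e) as Hep.
set (h := Rmin e d / 2).
assert (Hh : 0 < h /\ h < e /\ h < d).
{ pose proof (Rmin_l e d); pose proof (Rmin_r e d).
  assert (0 < Rmin e d) by (apply Rmin_pos; lra). unfold h; lra. }
specialize (He h ltac:(lra)).
rewrite Rabs_pos_eq in He by lra. specialize (He ltac:(lra)).
apply Rabs_def2 in He.
assert (Hq : 0 <= (f (x + h) - f x) / h).
{ apply Rdiv_le_0_compat; [|lra]. specialize (Hm (x + h) ltac:(lra)); lra. }
lra.
Qed.

Lemma is_derive_left_sign (f : R -> R) (x l d : R) :
  is_derive f x l -> 0 < d ->
  (forall y, x - d < y < x -> f x <= f y) -> l <= 0.
Proof.
intros Hf Hd Hm.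
assert (HD : Derive (fun z : R => f z) x = l) by (apply is_derive_unique; exact Hf).
enough (0 <= - l) by lra.
apply (is_derive_right_sign (fun y => f (- y)) (- x) (- l) d); [|lra|].
- auto_derive.
  + rewrite Ropp_involutive. exists l; exact Hf.
  + rewrite Ropp_involutive. rewrite HD. ring.
- intros y Hy. rewrite Ropp_involutive. apply Hm; lra.
Qed.

(** This is how comparison of time translates yields information on the time derivative: a lower
    bound linear in [h] for the increments survives the limit. *)
Lemma is_derive_right_ge (f : R -> R) (x l mu d : R) :
  is_derive f x l -> 0 < d ->
  (forall h, 0 < h < d -> h * mu <= f (x + h) - f x) -> mu <= l.
Proof.
intros Hf Hd Hm.
assert (HD : Derive (fun z : R => f z) x = l) by (apply is_derive_unique; exact Hf).
enough (0 <= l - mu) by lra.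
apply (is_derive_right_sign (fun y => f y - mu * y) x _ d); [|lra|].
- auto_derive; [exists l; exact Hf|].
  rewrite HD. ring.
- intros y Hy. specialize (Hm (y - x) ltac:(lra)).
  replace (x + (y - x)) with y in Hm by ring. lra.
Qed.

(** Identities such as [b = a sinh r] are available only on [[0, r0]], so at [r = r0] the two
    derivatives can be compared only from the left. *)
Lemma is_derive_eq_left (f g : R -> R) (x l l' d : R) :
  is_derive f x l -> is_derive g x l' -> 0 < d ->
  (forall y, x - d < y <= x -> f y = g y) -> l = l'.
Proof.
intros Hf Hg Hd He.
assert (aux : forall u v p q, is_derive u x p -> is_derive v x q ->
  (forall y, x - d < y <= x -> u y = v y) -> p <= q).
{ intros u v p q Hu Hv Huv.
  enough (p - q <= 0) by lra.
  apply (is_derive_left_sign (fun y => u y - v y) x _ d); [|lra|].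
  - apply (is_derive_minus u v); assumption.
  - intros y Hy. rewrite !Huv by lra. lra. }
apply Rle_antisym; [eapply aux|eapply aux]; eauto.
intros; symmetry; auto.
Qed.

(** A negative [l] would make [f'] negative just to the right of its zero [x], and the mean value
    theorem would push [f] below its minimum. *)
Lemma second_derivative_min (f f' : R -> R) (x l d : R) :
  0 < d -> (forall y, x - d < y < x + d -> is_derive f y (f' y)) ->
  is_derive f' x l -> (forall y, x - d < y < x + d -> f x <= f y) ->
  f' x = 0 /\ 0 <= l.
Proof.
intros Hd Hf Hf' Hm.
assert (H0 : f' x = 0).
{ apply Rle_antisym.
  - apply (is_derive_left_sign f x _ d); [apply Hf|..]; try lra. intros; apply Hm; lra.
  - apply (is_derive_right_sign f x _ d); [apply Hf|..]; try lra. intros; apply Hm; lra. }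
split; [exact H0|].
apply Rnot_lt_le; intros Hl.
apply is_derive_Reals in Hf'.
destruct (Hf' (- l) ltac:(lra)) as [e He].
pose proof (cond_pos e) as Hep.
set (h := Rmin e d / 2).
assert (Hh : 0 < h /\ h < e /\ h < d).
{ pose proof (Rmin_l e d); pose proof (Rmin_r e d).
  assert (0 < Rmin e d) by (apply Rmin_pos; lra). unfold h; lra. }
destruct (MVT_cor2 f f' x (x + h)) as [c [Hc1 Hc2]]; [lra| |].
{ intros c Hc. apply is_derive_Reals, Hf. lra. }
specialize (Hm (x + h) ltac:(lra)).
specialize (He (c - x) ltac:(lra)).
rewrite Rabs_pos_eq in He by lra. specialize (He ltac:(lra)).
apply Rabs_def2 in He.
replace (x + (c - x)) with c in He by ring.
rewrite H0 in He.
assert (f' c < 0).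
{ replace (f' c) with ((f' c - 0) / (c - x) * (c - x)) by (field; lra).
  assert ((f' c - 0) / (c - x) < 0) by lra. nra. }
nra.
Qed.

(** * Extrema of continuous functions on a rectangle *)

(** Uniform continuity with tolerance 1: the segment from the corner [(a, c)] to [(x, y)] is cut
    into [N] steps, each moving both coordinates by less than [e], so [Rabs f] grows by at most 1
    per step. [N] does not depend on the endpoint. *)
Lemma rectangle_bounded (f : R -> R -> R) (a b c d : R) :
  (forall x y, a <= x <= b -> c <= y <= d -> continuity_2d_pt f x y) ->
  exists M, forall x y, a <= x <= b -> c <= y <= d -> Rabs (f x y) <= M.
Proof.
intros Hf.
destruct (uniform_continuity_2d f a b c d Hf (mkposreal 1 Rlt_0_1)) as [e He].
simpl in He. pose proof (cond_pos e) as Hep.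
destruct (archimed (Rmax (b - a) (d - c) / e)) as [HN _].
set (z := up (Rmax (b - a) (d - c) / e)) in HN.
set (N := S (Z.to_nat z)).
assert (HN' : Rmax (b - a) (d - c) < e * INR N).
{ assert (IZR z <= INR N).
  { unfold N. rewrite S_INR. destruct (Z_le_dec 0 z).
    - rewrite INR_IZR_INZ, Z2Nat.id by lia. lra.
    - assert (IZR z < 0) by (apply IZR_lt; lia).
      pose proof (pos_INR (Z.to_nat z)). lra. }
  replace (Rmax (b - a) (d - c)) with (e * (Rmax (b - a) (d - c) / e)) by (field; lra).
  apply Rmult_lt_compat_l; lra. }
assert (HNp : 0 < INR N) by (apply lt_0_INR; unfold N; lia).
exists (Rabs (f a c) + INR N). intros x y Hx Hy.
pose proof (Rmax_l (b - a) (d - c)). pose proof (Rmax_r (b - a) (d - c)).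
set (p := (x - a) / INR N). set (q := (y - c) / INR N).
assert (Ep : x = a + INR N * p) by (unfold p; field; lra).
assert (Eq : y = c + INR N * q) by (unfold q; field; lra).
assert (Hp : 0 <= p < e).
{ split; [apply Rdiv_le_0_compat; lra|].
  apply Rmult_lt_reg_l with (INR N); [lra|]. lra. }
assert (Hq : 0 <= q < e).
{ split; [apply Rdiv_le_0_compat; lra|].
  apply Rmult_lt_reg_l with (INR N); [lra|]. lra. }
assert (Hi : forall i, (i <= N)%nat ->
  Rabs (f (a + INR i * p) (c + INR i * q)) <= Rabs (f a c) + INR i).
{ induction i as [|i IH]; intros Hi.
  - simpl. rewrite !Rmult_0_l, !Rplus_0_r. lra.
  - specialize (IH ltac:(lia)).
    assert (Hn : 0 <= INR i /\ INR i + 1 <= INR N).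
    { split; [apply pos_INR|]. rewrite <- S_INR. now apply le_INR. }
    rewrite S_INR.
    assert (Hstep := He (a + INR i * p) (c + INR i * q)
      (a + (INR i + 1) * p) (c + (INR i + 1) * q)).
    replace (a + (INR i + 1) * p - (a + INR i * p)) with p in Hstep by ring.
    replace (c + (INR i + 1) * q - (c + INR i * q)) with q in Hstep by ring.
    rewrite (Rabs_pos_eq p), (Rabs_pos_eq q) in Hstep by lra.
    assert (Hs := Hstep ltac:(split; nra) ltac:(split; nra) ltac:(split; nra)
       ltac:(split; nra) ltac:(lra) ltac:(lra)).
    set (u := f (a + (INR i + 1) * p) (c + (INR i + 1) * q)) in *.
    set (v := f (a + INR i * p) (c + INR i * q)) in *.
    replace u with (v + (u - v)) by ring.
    eapply Rle_trans; [apply Rabs_triang|]. lra. }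
specialize (Hi N (le_n N)). rewrite <- Ep, <- Eq in Hi. exact Hi.
Qed.

(** Let [m] be the supremum of [- f]. If it were not attained, [/ (f + m)] would be continuous,
    hence bounded by some [M'], and [m - / M'] would be a smaller upper bound. *)
Lemma rectangle_min (f : R -> R -> R) (a b c d : R) :
  a <= b -> c <= d ->
  (forall x y, a <= x <= b -> c <= y <= d -> continuity_2d_pt f x y) ->
  exists x0 y0, (a <= x0 <= b /\ c <= y0 <= d) /\
    forall x y, a <= x <= b -> c <= y <= d -> f x0 y0 <= f x y.
Proof.
intros Hab Hcd Hf.
destruct (rectangle_bounded f a b c d Hf) as [M HM].
set (E := fun z => exists x y, (a <= x <= b /\ c <= y <= d) /\ z = - f x y).
destruct (completeness E) as [m [Hub Hlub]].
{ exists M. intros z (x & y & [Hx Hy] & ->). specialize (HM x y Hx Hy).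
  pose proof (Rabs_maj2 (f x y)). lra. }
{ exists (- f a c), a, c. repeat split; lra. }
apply NNPP; intros Hno.
assert (Hpos : forall x y, a <= x <= b -> c <= y <= d -> 0 < f x y + m).
{ intros x y Hx Hy.
  assert (Hle : - f x y <= m) by (apply Hub; exists x, y; auto).
  destruct (Req_dec (f x y) (- m)) as [He|He]; [|lra].
  exfalso; apply Hno. exists x, y; split; [auto|]. intros u v Hu Hv.
  assert (- f u v <= m) by (apply Hub; exists u, v; auto). lra. }
destruct (rectangle_bounded (fun x y => / (f x y + m)) a b c d) as [M' HM'].
{ intros x y Hx Hy. apply continuity_2d_pt_inv.
  - apply continuity_2d_pt_plus; [auto|apply continuity_2d_pt_const].
  - specialize (Hpos x y Hx Hy); lra. }
assert (HM1 : 0 < M').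
{ eapply Rlt_le_trans; [|apply (HM' a c); lra].
  apply Rabs_pos_lt, Rinv_neq_0_compat. specialize (Hpos a c); lra. }
assert (Hm : m <= m - / M').
{ apply Hlub. intros z (x & y & [Hx Hy] & ->).
  specialize (HM' x y Hx Hy). specialize (Hpos x y Hx Hy).
  rewrite Rabs_pos_eq in HM' by (left; now apply Rinv_0_lt_compat).
  apply Rinv_le_contravar in HM'; [|now apply Rinv_0_lt_compat].
  rewrite Rinv_inv in HM'. lra. }
pose proof (Rinv_0_lt_compat M' HM1). lra.
Qed.

(** * Minimum principle for radial parabolic inequalities *)

(** Follows from [sinh r >= r] and [cosh r - sinh r = exp (- r) < 1]. It controls the first-order
    coefficient of the radial Laplacian, which is singular at the origin. *)
Lemma cosh_sinh_ratio_bounds (r : R) :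
  0 < r -> 0 < cosh r / sinh r <= 1 + / r.
Proof.
intros Hr.
assert (Hs : r <= sinh r).
{ destruct (MVT_cor2 sinh cosh 0 r) as [z [Hz _]]; [lra| |].
  { intros; apply derivable_pt_lim_sinh. }
  rewrite sinh_0 in Hz.
  assert (1 <= cosh z).
  { unfold cosh. pose proof (exp_ineq1_le z); pose proof (exp_ineq1_le (- z)). lra. }
  nra. }
assert (Hc : 0 < cosh r <= sinh r + 1).
{ unfold cosh, sinh. pose proof (exp_pos r); pose proof (exp_pos (- r)).
  assert (exp (- r) < 1) by (rewrite <- exp_0; apply exp_increasing; lra). lra. }
split; [apply Rdiv_lt_0_compat; lra|].
apply Rmult_le_reg_r with (sinh r); [lra|].
replace (cosh r / sinh r * sinh r) with (cosh r) by (field; lra).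
assert (1 <= / r * sinh r).
{ apply Rmult_le_reg_l with r; [lra|].
  replace (r * (/ r * sinh r)) with (sinh r) by (field; lra). lra. }
lra.
Qed.

(* Z is divided by exp (A (r^2 - r0 r) + L s): this weight has negative slope at the
   origin and slope larger than beta at r0, so that a negative minimum can sit
   neither at the boundary nor at the origin, where no equation is available. *)
Lemma parabolic_min_principle (r0 sa sb c0 q beta : R)
  (c Z Zr Zs Zrr : R -> R -> R) :
  0 < r0 -> 0 < c0 ->
  (forall r s, 0 <= r <= r0 -> sa <= s <= sb ->
     continuity_2d_pt Z r s /\ is_derive (fun x => Z x s) r (Zr r s) /\
     is_derive (fun u => Z r u) s (Zs r s)) ->
  (forall r s, 0 < r < r0 -> sa < s <= sb ->
     is_derive (fun x => Zr x s) r (Zrr r s)) ->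
  (forall r, 0 <= r <= r0 -> 0 <= Z r sa) ->
  (forall s, sa < s <= sb -> Zr 0 s <= 0) ->
  (forall s, sa < s <= sb -> Z r0 s < 0 -> beta * Z r0 s <= Zr r0 s) ->
  (forall r s, 0 < r < r0 -> sa < s <= sb -> Z r s < 0 ->
     c0 <= c r s /\
     Zrr r s + cosh r / sinh r * Zr r s + q * Z r s <= c r s * Zs r s) ->
  forall r s, 0 <= r <= r0 -> sa <= s <= sb -> 0 <= Z r s.
Proof.
intros Hr0 Hc0 HZ HZr Hinit Horig Hbd Hint r1 s1 Hr1 Hs1.
apply Rnot_lt_le; intros Hneg.
set (A := (Rabs beta + 1) / r0).
assert (HA : 0 < A).
{ apply Rdiv_lt_0_compat; [|lra]. pose proof (Rabs_pos beta); lra. }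
assert (HAr : beta < A * r0).
{ replace (A * r0) with (Rabs beta + 1) by (unfold A; field; lra).
  pose proof (Rle_abs beta); lra. }
(* [M1] bounds the coefficient of [Z] left at a negative minimum once [Zr] and [Zrr] are eliminated;
   [L] is chosen so that [c0 L = M1 + 1] exceeds it. *)
set (M1 := 2 * A + (A * r0) ^ 2 + A * (r0 + 2) + Rabs q).
assert (HM1 : 0 < M1).
{ unfold M1. pose proof (Rabs_pos q). pose proof (pow2_ge_0 (A * r0)). nra. }
set (L := (M1 + 1) / c0).
assert (HL : 0 < L) by (apply Rdiv_lt_0_compat; lra).
set (lam := fun r => A * (r * r - r0 * r)).
set (dl := fun r => A * (2 * r - r0)).
set (Y := fun r s => exp (- lam r - L * s) * Z r s).
destruct (rectangle_min Y 0 r0 sa sb) as (x & s & [Hx Hs] & Hmin); try lra.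
{ intros u v Hu Hv. unfold Y. apply continuity_2d_pt_mult; [|now apply HZ].
  apply (continuity_1d_2d_pt_comp exp).
  - apply derivable_continuous_pt, derivable_pt_exp.
  - apply continuity_2d_pt_minus.
    + apply continuity_2d_pt_opp. unfold lam.
      apply continuity_2d_pt_mult; [apply continuity_2d_pt_const|].
      apply continuity_2d_pt_minus; apply continuity_2d_pt_mult;
        first [apply continuity_2d_pt_id1|apply continuity_2d_pt_const].
    + apply continuity_2d_pt_mult;
        [apply continuity_2d_pt_const|apply continuity_2d_pt_id2]. }
assert (HYn : Y x s < 0).
{ eapply Rle_lt_trans; [apply (Hmin r1 s1); lra|].
  unfold Y. pose proof (exp_pos (- lam r1 - L * s1)). nra. }
assert (HZn : Z x s < 0).
{ unfold Y in HYn. pose proof (exp_pos (- lam x - L * s)). nra. }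
assert (Hsa : sa < s).
{ destruct (Req_dec s sa) as [->|]; [|lra]. specialize (Hinit x Hx). lra. }
set (E := fun y => exp (- lam y - L * s)).
assert (HE : forall y, 0 < E y) by (intros; apply exp_pos).
assert (HYr : forall y, 0 <= y <= r0 ->
  is_derive (fun z => Y z s) y (E y * (Zr y s - dl y * Z y s))).
{ intros y Hy. destruct (HZ y s Hy ltac:(lra)) as (_ & Hd & _).
  assert (HD : Derive (fun z => Z z s) y = Zr y s) by now apply is_derive_unique.
  unfold Y, lam. auto_derive; [exists (Zr y s); exact Hd|].
  rewrite HD. unfold E, lam, dl. ring_simplify. unfold Rminus. ring. }
destruct (Req_dec x 0) as [Hx0|Hx0].
{ subst x.
  assert (H := is_derive_right_sign _ _ _ r0 (HYr 0 Hx) Hr0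
     ltac:(intros; apply Hmin; lra)).
  specialize (Horig s ltac:(lra)). specialize (HE 0).
  assert (Hd0 : dl 0 = - (A * r0)) by (unfold dl; ring).
  assert (0 < A * r0) by nra.
  assert (Zr 0 s - dl 0 * Z 0 s < 0) by (rewrite Hd0; nra). nra. }
destruct (Req_dec x r0) as [Hx1|Hx1].
{ subst x.
  assert (H := is_derive_left_sign _ _ _ r0 (HYr r0 Hx) Hr0
     ltac:(intros; apply Hmin; lra)).
  specialize (Hbd s ltac:(lra) HZn). specialize (HE r0).
  assert (Hd0 : dl r0 = A * r0) by (unfold dl; ring).
  assert (0 < Zr r0 s - dl r0 * Z r0 s) by (rewrite Hd0; nra). nra. }
destruct (Hint x s ltac:(lra) ltac:(lra) HZn) as [Hc Hpde].
destruct (second_derivative_min (fun z => Y z s)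
  (fun y => E y * (Zr y s - dl y * Z y s)) x
  (E x * (Zrr x s - 2 * dl x * Zr x s + dl x ^ 2 * Z x s - 2 * A * Z x s))
  (Rmin x (r0 - x))) as [H1 H2].
{ apply Rmin_pos; lra. }
{ intros y Hy. pose proof (Rmin_l x (r0 - x)); pose proof (Rmin_r x (r0 - x)).
  apply HYr; lra. }
{ destruct (HZ x s Hx ltac:(lra)) as (_ & Hd & _).
  assert (Hd2 := HZr x s ltac:(lra) ltac:(lra)).
  assert (HD : Derive (fun z => Z z s) x = Zr x s) by now apply is_derive_unique.
  assert (HD2 : Derive (fun z => Zr z s) x = Zrr x s) by now apply is_derive_unique.
  unfold E, lam, dl. auto_derive.
  { split; [exists (Zrr x s); exact Hd2|split; [exists (Zr x s); exact Hd|exact I]]. }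
  rewrite HD, HD2. unfold Rminus. ring. }
{ intros y Hy. pose proof (Rmin_l x (r0 - x)); pose proof (Rmin_r x (r0 - x)).
  apply Hmin; lra. }
specialize (HE x).
assert (Er : Zr x s = dl x * Z x s).
{ apply Rmult_integral in H1. lra. }
assert (Err : (dl x ^ 2 + 2 * A) * Z x s <= Zrr x s).
{ rewrite Er in H2.
  assert (0 <= Zrr x s - 2 * dl x * (dl x * Z x s) + dl x ^ 2 * Z x s - 2 * A * Z x s)
    by (apply Rmult_le_reg_l with (E x); [lra|]; rewrite Rmult_0_r; exact H2).
  lra. }
(* The minimum may sit at the final time [sb], so only earlier times are compared with it. *)
assert (Hts : Zs x s <= L * Z x s).
{ destruct (HZ x s Hx ltac:(lra)) as (_ & _ & Hd).
  assert (HD : Derive (fun z => Z x z) s = Zs x s) by now apply is_derive_unique.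
  assert (H : E x * (Zs x s - L * Z x s) <= 0).
  { apply (is_derive_left_sign (fun u => Y x u) s _ (s - sa)); [|lra|].
    - unfold Y, lam, E. auto_derive; [exists (Zs x s); exact Hd|].
      rewrite HD. unfold lam, Rminus. ring.
    - intros u Hu. apply Hmin; lra. }
  nra. }
(* The slope [dl] is nonpositive for [x <= r0 / 2], where the singular coefficient therefore helps;
   beyond that, the bound [1 + / x] suffices. *)
assert (Hcoth : cosh x / sinh x * dl x <= A * (r0 + 2)).
{ destruct (cosh_sinh_ratio_bounds x ltac:(lra)) as [Hk1 Hk2].
  unfold dl. set (k := cosh x / sinh x) in *.
  destruct (Rle_lt_dec (2 * x - r0) 0) as [Hd|Hd].
  - assert (0 <= k * - (2 * x - r0)) by (apply Rmult_le_pos; lra). nra.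
  - assert (k * (2 * x - r0) <= r0 + 2).
    { apply Rle_trans with ((1 + / x) * (2 * x - r0)).
      - apply Rmult_le_compat_r; lra.
      - assert (0 < / x) by (apply Rinv_0_lt_compat; lra).
        replace ((1 + / x) * (2 * x - r0)) with (2 * x - r0 + 2 - / x * r0) by (field; lra).
        assert (0 <= / x * r0) by (apply Rmult_le_pos; lra). lra. }
    replace (k * (A * (2 * x - r0))) with (A * (k * (2 * x - r0))) by ring.
    apply Rmult_le_compat_l; lra. }
assert (Hdl : dl x ^ 2 <= (A * r0) ^ 2).
{ unfold dl. assert (A * -r0 <= A * (2 * x - r0) <= A * r0)
    by (split; apply Rmult_le_compat_l; lra). nra. }
assert (Hq := Rle_abs q).
assert (HcL : M1 + 1 <= c x s * L).
{ replace (M1 + 1) with (c0 * L) by (unfold L; field; lra).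
  apply Rmult_le_compat_r; lra. }
(* As [Z x s < 0], this forces the coefficient on the left to be at least [c L >= M1 + 1], against
   its bound [M1]. *)
assert (Hfin : (dl x ^ 2 + 2 * A + cosh x / sinh x * dl x + q) * Z x s <= c x s * L * Z x s).
{ assert (c x s * Zs x s <= c x s * (L * Z x s)) by (apply Rmult_le_compat_l; lra).
  rewrite Er in Hpde. lra. }
assert (HM : dl x ^ 2 + 2 * A + cosh x / sinh x * dl x + q <= M1) by (unfold M1; lra).
nra.
Qed.

(** * Monotonicity of the logarithmic flow *)

(** [lf_pde] is the curvature formula for the conformal metric [xi exp (2 G) g_{-1}], with [Gs + 1]
    standing for [- xi K]; the final 1 reflects that [g_{-1}] has curvature -1. [lf_boundary] is the
    prescribed geodesic curvature. *)
Record log_flow (r0 s0 s1 : R) (sigma : R -> R) (G Gr Gs Grr : R -> R -> R) : Prop := {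
  lf_cont : forall r s, 0 <= r <= r0 -> s0 <= s < s1 -> continuity_2d_pt G r s;
  lf_cont_s : forall r s, 0 <= r <= r0 -> s0 <= s < s1 -> continuity_2d_pt Gs r s;
  lf_dr : forall r s, 0 <= r <= r0 -> s0 <= s < s1 ->
    is_derive (fun x => G x s) r (Gr r s);
  lf_ds : forall r s, 0 <= r <= r0 -> s0 <= s < s1 ->
    is_derive (fun u => G r u) s (Gs r s);
  lf_drr : forall r s, 0 < r < r0 -> s0 <= s < s1 ->
    is_derive (fun x => Gr x s) r (Grr r s);
  lf_pde : forall r s, 0 < r < r0 -> s0 <= s < s1 ->
    exp (2 * G r s) * (Gs r s + 1) = Grr r s + cosh r / sinh r * Gr r s + 1;
  lf_origin : forall s, s0 <= s < s1 -> Gr 0 s = 0;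
  lf_boundary : forall s, s0 <= s < s1 ->
    Gr r0 s = cosh r0 / sinh r0 * (exp (G r0 s) - 1) + exp (G r0 s) * sigma s;
  lf_init : forall r, 0 <= r <= r0 -> G r s0 = 0
}.

Arguments lf_cont {r0 s0 s1 sigma G Gr Gs Grr}.
Arguments lf_cont_s {r0 s0 s1 sigma G Gr Gs Grr}.
Arguments lf_dr {r0 s0 s1 sigma G Gr Gs Grr}.
Arguments lf_ds {r0 s0 s1 sigma G Gr Gs Grr}.
Arguments lf_drr {r0 s0 s1 sigma G Gr Gs Grr}.
Arguments lf_pde {r0 s0 s1 sigma G Gr Gs Grr}.
Arguments lf_origin {r0 s0 s1 sigma G Gr Gs Grr}.
Arguments lf_boundary {r0 s0 s1 sigma G Gr Gs Grr}.
Arguments lf_init {r0 s0 s1 sigma G Gr Gs Grr}.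

Lemma continuity_2d_pt_comp_r (f : R -> R -> R) (g : R -> R) (x y : R) :
  continuity_2d_pt f x (g y) -> continuity_pt g y ->
  continuity_2d_pt (fun u v => f u (g v)) x y.
Proof.
intros Hf Hg e. destruct (Hf e) as [d Hd].
destruct (proj1 (continuity_pt_locally g y) Hg d) as [d' Hd'].
exists (mkposreal _ (Rmin_stable_in_posreal d d')). simpl. intros u v Hu Hv.
apply Hd.
- eapply Rlt_le_trans; [exact Hu|apply Rmin_l].
- apply Hd'. eapply Rlt_le_trans; [exact Hv|apply Rmin_r].
Qed.

Lemma continuity_2d_pt_shift (f : R -> R -> R) (x y h : R) :
  continuity_2d_pt f x (y + h) -> continuity_2d_pt (fun u v => f u (v + h)) x y.
Proof.
intros Hf. apply (continuity_2d_pt_comp_r f (fun v => v + h)); [exact Hf|].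
apply derivable_continuous_pt. reg.
Qed.

Lemma is_derive_shift (f : R -> R) (x h l : R) :
  is_derive f (x + h) l -> is_derive (fun u => f (u + h)) x l.
Proof.
intros Hf.
assert (HD : Derive (fun z : R => f z) (x + h) = l) by (apply is_derive_unique; exact Hf).
auto_derive; [exists l; exact Hf|]. rewrite HD; ring.
Qed.

Lemma exp_le (x y : R) : x <= y -> exp x <= exp y.
Proof. intros [H| ->]; [left; now apply exp_increasing|apply Rle_refl]. Qed.

(** Convexity: the tangent to [exp] at [y] lies below the graph. *)
Lemma exp_diff_le (x y : R) : exp y - exp x <= exp y * (y - x).
Proof.
replace (exp x) with (exp y * exp (x - y)) by (rewrite <- exp_plus; f_equal; ring).
pose proof (exp_ineq1_le (x - y)). pose proof (exp_pos y). nra.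
Qed.

Lemma exp_lipschitz (M x y : R) :
  x <= M -> y <= M -> Rabs (exp x - exp y) <= exp M * Rabs (x - y).
Proof.
intros Hx Hy. pose proof (exp_le x M Hx). pose proof (exp_le y M Hy).
pose proof (exp_diff_le x y). pose proof (exp_diff_le y x).
pose proof (exp_pos x). pose proof (exp_pos y).
pose proof (Rle_abs (x - y)). pose proof (Rabs_maj2 (x - y)).
pose proof (Rabs_pos (x - y)).
apply Rabs_le; split.
- assert (exp y * (y - x) <= exp y * Rabs (x - y)) by (apply Rmult_le_compat_l; lra).
  assert (exp y * Rabs (x - y) <= exp M * Rabs (x - y)) by (apply Rmult_le_compat_r; lra).
  lra.
- assert (exp x * (x - y) <= exp x * Rabs (x - y)) by (apply Rmult_le_compat_l; lra).
  assert (exp x * Rabs (x - y) <= exp M * Rabs (x - y)) by (apply Rmult_le_compat_r; lra).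
  lra.
Qed.

(** Nothing is known at the end [s1], so bounds come from compactness of [[s0, S]]. The combination
    [Gs + 1] is the factor that multiplies the difference of exponentials when two equations are
    subtracted. *)
Lemma log_flow_bounds r0 s0 s1 sigma G Gr Gs Grr S :
  log_flow r0 s0 s1 sigma G Gr Gs Grr -> S < s1 ->
  exists M, 0 <= M /\ forall r s, 0 <= r <= r0 -> s0 <= s <= S ->
    - M <= G r s <= M /\ Rabs (Gs r s + 1) <= M + 1.
Proof.
intros lf HS.
destruct (rectangle_bounded G 0 r0 s0 S) as [M1 H1].
{ intros; apply (lf_cont lf); lra. }
destruct (rectangle_bounded Gs 0 r0 s0 S) as [M2 H2].
{ intros; apply (lf_cont_s lf); lra. }
exists (Rmax 0 (Rmax M1 M2)).
pose proof (Rmax_l 0 (Rmax M1 M2)). pose proof (Rmax_r 0 (Rmax M1 M2)).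
pose proof (Rmax_l M1 M2). pose proof (Rmax_r M1 M2).
split; [assumption|]. intros r s Hr Hs. split.
- specialize (H1 r s Hr Hs). apply Rabs_le_between in H1. lra.
- specialize (H2 r s Hr Hs). eapply Rle_trans; [apply Rabs_triang|].
  rewrite Rabs_R1. lra.
Qed.

(** Where [G < 0], the inequality [exp (2 G) <= 1] absorbs the constant terms of the equation, and
    [exp G - 1 >= G] makes the boundary condition linear with slope [coth r0]. This supplies the
    initial comparison for time translates. *)
Lemma log_flow_nonneg r0 s0 s1 sigma G Gr Gs Grr :
  log_flow r0 s0 s1 sigma G Gr Gs Grr -> 0 < r0 ->
  (forall s, s0 <= s < s1 -> 0 <= sigma s) ->
  forall r s, 0 <= r <= r0 -> s0 <= s < s1 -> 0 <= G r s.
Proof.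
intros lf Hr0 Hsig r s Hr Hs.
destruct (log_flow_bounds _ _ _ _ _ _ _ _ s lf ltac:(lra)) as (M & HM & Hb).
destruct (cosh_sinh_ratio_bounds r0 Hr0) as [Hk _].
apply (parabolic_min_principle r0 s0 s (exp (- (2 * M))) 0 (cosh r0 / sinh r0)
  (fun r s => exp (2 * G r s)) G Gr Gs Grr); try assumption; try lra.
- apply exp_pos.
- intros x u Hx Hu. split; [|split].
  + apply (lf_cont lf); lra.
  + apply (lf_dr lf); lra.
  + apply (lf_ds lf); lra.
- intros. apply (lf_drr lf); lra.
- intros. rewrite (lf_init lf) by lra. lra.
- intros. rewrite (lf_origin lf) by lra. lra.
- intros u Hu Hn. rewrite (lf_boundary lf) by lra.
  pose proof (exp_ineq1_le (G r0 u)). pose proof (exp_pos (G r0 u)).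
  specialize (Hsig u ltac:(lra)).
  assert (0 <= exp (G r0 u) * sigma u) by (apply Rmult_le_pos; lra).
  assert (cosh r0 / sinh r0 * G r0 u <= cosh r0 / sinh r0 * (exp (G r0 u) - 1))
    by (apply Rmult_le_compat_l; lra).
  lra.
- intros x u Hx Hu Hn. split.
  + apply exp_le. specialize (Hb x u ltac:(lra) ltac:(lra)). lra.
  + assert (Hp := lf_pde lf x u ltac:(lra) ltac:(lra)).
    assert (exp (2 * G x u) <= exp 0) by (apply exp_le; lra).
    rewrite exp_0 in H. lra.
Qed.

(* Subtracting the two equations and linearising only the exponential avoids any
   time derivative of the coefficients. *)
Lemma log_flow_diff_pde r0 s0 s1 sigma G Gr Gs Grr M S r s h :
  log_flow r0 s0 s1 sigma G Gr Gs Grr -> S < s1 ->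
  (forall r s, 0 <= r <= r0 -> s0 <= s <= S ->
    - M <= G r s <= M /\ Rabs (Gs r s + 1) <= M + 1) ->
  0 < r < r0 -> s0 <= s -> 0 <= h -> s + h <= S ->
  Rabs (exp (2 * G r (s + h)) * (Gs r (s + h) - Gs r s) -
    (Grr r (s + h) - Grr r s + cosh r / sinh r * (Gr r (s + h) - Gr r s)))
  <= 2 * exp (2 * M) * (M + 1) * Rabs (G r (s + h) - G r s).
Proof.
intros lf HS Hb Hr Hs Hh HhS.
assert (P1 := lf_pde lf r s ltac:(lra) ltac:(lra)).
assert (P2 := lf_pde lf r (s + h) ltac:(lra) ltac:(lra)).
destruct (Hb r s ltac:(lra) ltac:(lra)) as [B1 B2].
destruct (Hb r (s + h) ltac:(lra) ltac:(lra)) as [B3 _].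
assert (HL := exp_lipschitz (2 * M) (2 * G r (s + h)) (2 * G r s) ltac:(lra) ltac:(lra)).
replace (2 * G r (s + h) - 2 * G r s) with (2 * (G r (s + h) - G r s)) in HL by ring.
rewrite Rabs_mult, (Rabs_pos_eq 2) in HL by lra.
match goal with |- Rabs ?X <= _ =>
  replace X with (- ((exp (2 * G r (s + h)) - exp (2 * G r s)) * (Gs r s + 1))) by lra end.
rewrite Rabs_Ropp, Rabs_mult.
eapply Rle_trans; [apply Rmult_le_compat; [apply Rabs_pos|apply Rabs_pos|exact HL|exact B2]|].
lra.
Qed.

(** Minimum principle for [V = G (s + h) - G s]. Initially [V] is [G (s0 + h) >= 0]; where [V < 0]
    the linearisation error is at most [- q V], which has the sign that the principle allows. *)
Lemma log_flow_monotone r0 s0 s1 sigma G Gr Gs Grr :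
  log_flow r0 s0 s1 sigma G Gr Gs Grr -> 0 < r0 -> 0 <= sigma s0 ->
  (forall s s', s0 <= s <= s' -> s' < s1 -> sigma s <= sigma s') ->
  forall r s h, 0 <= r <= r0 -> s0 <= s -> 0 <= h -> s + h < s1 ->
  G r s <= G r (s + h).
Proof.
intros lf Hr0 Hs0 Hmono r s h Hr Hs Hh Hsh.
assert (Hsig : forall u, s0 <= u < s1 -> 0 <= sigma u).
{ intros u Hu. specialize (Hmono s0 u ltac:(lra) ltac:(lra)). lra. }
destruct (log_flow_bounds _ _ _ _ _ _ _ _ (s + h) lf ltac:(lra)) as (M & HM & Hb).
destruct (cosh_sinh_ratio_bounds r0 Hr0) as [Hk _].
set (q := 2 * exp (2 * M) * (M + 1)).
enough (0 <= G r (s + h) - G r s) by lra.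
apply (parabolic_min_principle r0 s0 s (exp (- (2 * M))) q
  ((cosh r0 / sinh r0 + sigma s) * exp M)
  (fun r s => exp (2 * G r (s + h))) (fun r s => G r (s + h) - G r s)
  (fun r s => Gr r (s + h) - Gr r s) (fun r s => Gs r (s + h) - Gs r s)
  (fun r s => Grr r (s + h) - Grr r s)); try assumption; try lra.
- apply exp_pos.
- intros x u Hx Hu. split; [|split].
  + apply continuity_2d_pt_minus;
      [apply continuity_2d_pt_shift|]; apply (lf_cont lf); lra.
  + apply (is_derive_minus (fun x => G x (u + h)) (fun x => G x u));
      apply (lf_dr lf); lra.
  + apply (is_derive_minus (fun v => G x (v + h)) (fun v => G x v));
      [apply (is_derive_shift (fun v => G x v))|]; apply (lf_ds lf); lra.
- intros x u Hx Hu. apply (is_derive_minus (fun x => Gr x (u + h)) (fun x => Gr x u));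
      apply (lf_drr lf); lra.
- intros x Hx. rewrite (lf_init lf x) by lra.
  enough (0 <= G x (s0 + h)) by lra.
  apply (log_flow_nonneg _ _ _ _ _ _ _ _ lf); auto; lra.
- intros. rewrite !(lf_origin lf) by lra. lra.
- intros u Hu Hn. rewrite !(lf_boundary lf) by lra.
  assert (S1 := Hmono u (u + h) ltac:(lra) ltac:(lra)).
  assert (S2 := Hmono u s ltac:(lra) ltac:(lra)).
  assert (S3 := Hsig u ltac:(lra)).
  destruct (Hb r0 u ltac:(lra) ltac:(lra)) as [B1 _].
  set (P := G r0 (u + h)) in *. set (F := G r0 u) in *. set (k := cosh r0 / sinh r0) in *.
  pose proof (exp_pos P). pose proof (exp_pos M).
  (* The negative number [P - F] only decreases under larger factors: [exp M] enters by convexity,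
     and [sigma s], the largest value up to time [s], replaces [sigma u]. The result is a slope
     constant in time. *)
  assert (HE : exp M * (P - F) <= exp P - exp F).
  { pose proof (exp_diff_le P F). assert (exp F <= exp M) by (apply exp_le; lra).
    assert (exp F * (F - P) <= exp M * (F - P)) by (apply Rmult_le_compat_r; lra). lra. }
  assert (exp P * sigma u <= exp P * sigma (u + h)) by (apply Rmult_le_compat_l; lra).
  assert ((k + sigma u) * (exp M * (P - F)) <= (k + sigma u) * (exp P - exp F))
    by (apply Rmult_le_compat_l; lra).
  assert ((k + sigma s) * (exp M * (P - F)) <= (k + sigma u) * (exp M * (P - F))).
  { assert (exp M * (P - F) <= 0) by nra. nra. }
  lra.
- intros x u Hx Hu Hn. split.
  + apply exp_le. specialize (Hb x (u + h) ltac:(lra) ltac:(lra)). lra.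
  + assert (Hp := log_flow_diff_pde _ _ _ _ _ _ _ _ M (s + h) x u h lf
      ltac:(lra) Hb ltac:(lra) ltac:(lra) ltac:(lra) ltac:(lra)).
    fold q in Hp. rewrite (Rabs_left (G x (u + h) - G x u)) in Hp by lra.
    apply Rabs_le_between in Hp. lra.
Qed.

(** Minimum principle for the increment of [G] minus [zeta]. The increment is already nonnegative,
    so the difference can be negative only where [zeta > 0], and the interior inequality is demanded
    only there. The number [c] stands for [exp (2 G)], known only up to bounds. At the boundary the
    terms with [exp P - exp F] are nonnegative and dropped; the growth of [sigma] remains. *)
Lemma log_flow_barrier r0 s0 s1 sigma G Gr Gs Grr M S sa sb h
  (zeta zr zs zrr : R -> R -> R) :
  log_flow r0 s0 s1 sigma G Gr Gs Grr -> 0 < r0 -> 0 <= sigma s0 ->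
  (forall s s', s0 <= s <= s' -> s' < s1 -> sigma s <= sigma s') ->
  S < s1 ->
  (forall r s, 0 <= r <= r0 -> s0 <= s <= S ->
    - M <= G r s <= M /\ Rabs (Gs r s + 1) <= M + 1) ->
  s0 <= sa -> 0 <= h -> sb + h <= S ->
  (forall r s, continuity_2d_pt zeta r s) ->
  (forall r s, is_derive (fun x => zeta x s) r (zr r s)) ->
  (forall r s, is_derive (fun u => zeta r u) s (zs r s)) ->
  (forall r s, is_derive (fun x => zr x s) r (zrr r s)) ->
  (forall r, 0 <= r <= r0 -> zeta r sa <= G r (sa + h) - G r sa) ->
  (forall s, sa < s <= sb -> 0 <= zr 0 s) ->
  (forall s, sa < s <= sb -> zr r0 s <= exp (- M) * (sigma (s + h) - sigma s)) ->
  (forall r s c, 0 < r < r0 -> sa < s <= sb -> 0 < zeta r s ->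
    exp (- (2 * M)) <= c <= exp (2 * M) ->
    c * zs r s + 2 * exp (2 * M) * (M + 1) * zeta r s
      <= zrr r s + cosh r / sinh r * zr r s) ->
  forall r s, 0 <= r <= r0 -> sa <= s <= sb -> zeta r s <= G r (s + h) - G r s.
Proof.
intros lf Hr0 Hs0 Hmono HS Hb Hsa Hh HsbS Cz Dr Ds Drr Hi Ho Hbd Hin r s Hr Hs.
assert (Hsig : forall u, s0 <= u < s1 -> 0 <= sigma u).
{ intros u Hu. specialize (Hmono s0 u ltac:(lra) ltac:(lra)). lra. }
assert (HV : forall x u, 0 <= x <= r0 -> sa <= u <= sb -> 0 <= G x (u + h) - G x u).
{ intros x u Hx Hu.
  assert (G x u <= G x (u + h)) by (apply (log_flow_monotone _ _ _ _ _ _ _ _ lf); auto; lra).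
  lra. }
destruct (cosh_sinh_ratio_bounds r0 Hr0) as [Hk _].
assert (HM : 0 <= M + 1).
{ destruct (Hb r sa ltac:(lra) ltac:(lra)) as [_ H]. pose proof (Rabs_pos (Gs r sa + 1)). lra. }
set (q := 2 * exp (2 * M) * (M + 1)) in *.
assert (Hq : 0 <= q).
{ unfold q. pose proof (exp_pos (2 * M)). apply Rmult_le_pos; lra. }
enough (0 <= G r (s + h) - G r s - zeta r s) by lra.
apply (parabolic_min_principle r0 sa sb (exp (- (2 * M))) 0 0
  (fun r s => exp (2 * G r (s + h))) (fun r s => G r (s + h) - G r s - zeta r s)
  (fun r s => Gr r (s + h) - Gr r s - zr r s) (fun r s => Gs r (s + h) - Gs r s - zs r s)
  (fun r s => Grr r (s + h) - Grr r s - zrr r s)); try assumption; try lra.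
- apply exp_pos.
- intros x u Hx Hu. split; [|split].
  + apply continuity_2d_pt_minus; [|apply Cz]. apply continuity_2d_pt_minus;
      [apply continuity_2d_pt_shift|]; apply (lf_cont lf); lra.
  + apply (is_derive_minus (fun x => G x (u + h) - G x u) (fun x => zeta x u)); [|apply Dr].
    apply (is_derive_minus (fun x => G x (u + h)) (fun x => G x u));
      apply (lf_dr lf); lra.
  + apply (is_derive_minus (fun v => G x (v + h) - G x v) (fun v => zeta x v)); [|apply Ds].
    apply (is_derive_minus (fun v => G x (v + h)) (fun v => G x v));
      [apply (is_derive_shift (fun v => G x v))|]; apply (lf_ds lf); lra.
- intros x u Hx Hu.
  apply (is_derive_minus (fun x => Gr x (u + h) - Gr x u) (fun x => zr x u)); [|apply Drr].
  apply (is_derive_minus (fun x => Gr x (u + h)) (fun x => Gr x u));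
      apply (lf_drr lf); lra.
- intros x Hx. specialize (Hi x Hx). lra.
- intros u Hu. rewrite !(lf_origin lf) by lra. specialize (Ho u Hu). lra.
- intros u Hu Hn. rewrite !(lf_boundary lf) by lra.
  assert (S1 := Hmono u (u + h) ltac:(lra) ltac:(lra)).
  assert (S3 := Hsig u ltac:(lra)).
  destruct (Hb r0 (u + h) ltac:(lra) ltac:(lra)) as [B1 _].
  specialize (HV r0 u ltac:(lra) ltac:(lra)). specialize (Hbd u Hu).
  set (P := G r0 (u + h)) in *. set (F := G r0 u) in *. set (k := cosh r0 / sinh r0) in *.
  assert (exp F <= exp P) by (apply exp_le; lra).
  assert (exp (- M) <= exp P) by (apply exp_le; lra).
  assert (0 <= (k + sigma u) * (exp P - exp F)) by (apply Rmult_le_pos; lra).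
  assert (exp (- M) * (sigma (u + h) - sigma u) <= exp P * (sigma (u + h) - sigma u))
    by (apply Rmult_le_compat_r; lra).
  lra.
- intros x u Hx Hu Hn.
  destruct (Hb x (u + h) ltac:(lra) ltac:(lra)) as [B1 _].
  assert (He : exp (- (2 * M)) <= exp (2 * G x (u + h)) <= exp (2 * M))
    by (split; apply exp_le; lra).
  split; [apply He|].
  specialize (HV x u ltac:(lra) ltac:(lra)).
  assert (Hp := log_flow_diff_pde _ _ _ _ _ _ _ _ M S x u h lf
      ltac:(lra) Hb ltac:(lra) ltac:(lra) ltac:(lra) ltac:(lra)).
  fold q in Hp. rewrite (Rabs_pos_eq (G x (u + h) - G x u)) in Hp by lra.
  apply Rabs_le_between in Hp.
  specialize (Hin x u _ Hx Hu ltac:(lra) He).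
  (* The increment lies below [zeta] here, so its linearisation error is covered by the term
     [q zeta] built into the barrier inequality. *)
  assert (q * (G x (u + h) - G x u) <= q * zeta x u) by (apply Rmult_le_compat_l; lra).
  lra.
Qed.

(* The exponential in [r] has positive slope at the origin, a convex kink that a
   radial subsolution may have, and is steep enough to cross the disc during
   [sa, sb]; only the growth of [sigma] there feeds it at the boundary. *)
Lemma log_flow_ignition r0 s0 s1 sigma G Gr Gs Grr M S sa sb h0 gam :
  log_flow r0 s0 s1 sigma G Gr Gs Grr -> 0 < r0 -> 0 <= sigma s0 ->
  (forall s s', s0 <= s <= s' -> s' < s1 -> sigma s <= sigma s') ->
  S < s1 -> 0 <= M ->
  (forall r s, 0 <= r <= r0 -> s0 <= s <= S ->
    - M <= G r s <= M /\ Rabs (Gs r s + 1) <= M + 1) ->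
  s0 <= sa < sb -> sb + h0 <= S -> 0 < gam ->
  (forall s h, sa <= s <= sb -> 0 < h < h0 -> gam * h <= sigma (s + h) - sigma s) ->
  exists mu, 0 < mu /\
    forall r h, 0 <= r <= r0 -> 0 < h < h0 -> h * mu <= G r (sb + h) - G r sb.
Proof.
intros lf Hr0 Hs0 Hmono HS HM Hb Hsab HsbS Hgam Hsig.
set (q := 2 * exp (2 * M) * (M + 1)) in *.
set (C := exp (2 * M)). set (d := sb - sa).
assert (HC : 0 < C) by apply exp_pos.
assert (Hq : 0 < q) by (unfold q; fold C; nra).
assert (Hd : 0 < d) by (unfold d; lra).
(* The barrier will be [h eps (exp (A r + B (s - sa)) - exp (A r0))]. This [A] gives
   [A ^ 2 = A + A q + C B], hence the interior inequality. *)
set (A := 1 + q + 2 * C * r0 / d).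
assert (HA2 : 0 < 2 * C * r0 / d) by (apply Rdiv_lt_0_compat; nra).
assert (HA : 1 <= A) by (unfold A; lra).
(* The zero set of the barrier starts at [r = r0] when [s = sa] and reaches the origin halfway
   through [[sa, sb]], as [B d = 2 A r0]. *)
set (B := 2 * A * r0 / d).
assert (HB : 0 < B) by (apply Rdiv_lt_0_compat; nra).
assert (HAB : C * B + q <= A ^ 2).
{ replace (A ^ 2) with (A * q + A + C * B) by (unfold B, A; field; lra). nra. }
(* The exponential is at most [exp (3 A r0)] on the boundary up to [sb], so [eps] keeps the boundary
   slope below [exp (- M) gam h]. *)
set (eps := exp (- M) * gam / (A * exp (3 * A * r0))).
pose proof (exp_pos (- M)). pose proof (exp_pos (3 * A * r0)).
assert (Heps : 0 < eps) by (apply Rdiv_lt_0_compat; nra).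
set (E := fun r s => exp (A * r + B * (s - sa))).
assert (HE : forall r s, 0 < E r s) by (intros; apply exp_pos).
exists (eps * (exp (2 * A * r0) - exp (A * r0))). split.
{ assert (exp (A * r0) < exp (2 * A * r0)) by (apply exp_increasing; nra).
  apply Rmult_lt_0_compat; lra. }
intros r h Hr Hh.
assert (Hhe : 0 < h * eps) by (apply Rmult_lt_0_compat; lra).
assert (HheA : 0 < h * eps * A) by (apply Rmult_lt_0_compat; lra).
assert (Hz : h * eps * (E r sb - exp (A * r0)) <= G r (sb + h) - G r sb).
{ apply (log_flow_barrier r0 s0 s1 sigma G Gr Gs Grr M S sa sb h
    (fun r s => h * eps * (E r s - exp (A * r0))) (fun r s => h * eps * A * E r s)
    (fun r s => h * eps * B * E r s) (fun r s => h * eps * A ^ 2 * E r s));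
    try assumption; try lra; fold q C.
  - intros x u. apply continuity_2d_pt_mult; [apply continuity_2d_pt_const|].
    apply continuity_2d_pt_minus; [|apply continuity_2d_pt_const].
    apply (continuity_1d_2d_pt_comp exp).
    + apply derivable_continuous_pt, derivable_pt_exp.
    + apply continuity_2d_pt_plus; apply continuity_2d_pt_mult;
        try apply continuity_2d_pt_const; [apply continuity_2d_pt_id1|].
      apply continuity_2d_pt_minus; [apply continuity_2d_pt_id2|apply continuity_2d_pt_const].
  - intros x u. unfold E. auto_derive; [exact I|]. unfold Rminus; ring.
  - intros x u. unfold E. auto_derive; [exact I|]. unfold Rminus; ring.
  - intros x u. unfold E. auto_derive; [exact I|]. unfold Rminus; ring.
  - intros x Hx.
    assert (G x sa <= G x (sa + h))
      by (apply (log_flow_monotone _ _ _ _ _ _ _ _ lf); auto; lra).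
    assert (E x sa <= exp (A * r0)) by (apply exp_le; nra).
    nra.
  - intros u Hu. specialize (HE 0 u).
    left; apply Rmult_lt_0_compat; lra.
  - intros u Hu. specialize (Hsig u h ltac:(lra) Hh).
    assert (HEu : E r0 u <= exp (3 * A * r0)).
    { apply exp_le. assert (B * (u - sa) <= B * d) by (apply Rmult_le_compat_l; unfold d; lra).
      assert (B * d = 2 * A * r0) by (unfold B; field; lra). lra. }
    apply Rle_trans with (exp (- M) * (gam * h)); [|apply Rmult_le_compat_l; lra].
    apply Rle_trans with (h * eps * A * exp (3 * A * r0)).
    + apply Rmult_le_compat_l; [lra|exact HEu].
    + right. unfold eps. field. split; lra.
  - intros x u c Hx Hu Hzp Hc. specialize (HE x u).
    destruct (cosh_sinh_ratio_bounds x ltac:(lra)) as [Hk _].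
    assert (0 < exp (A * r0)) by apply exp_pos.
    assert (0 <= cosh x / sinh x * (h * eps * A * E x u)).
    { apply Rmult_le_pos; [lra|]. left; apply Rmult_lt_0_compat; lra. }
    assert (HEh : 0 < h * eps * E x u) by (apply Rmult_lt_0_compat; lra).
    assert (c * B * (h * eps * E x u) <= C * B * (h * eps * E x u)).
    { apply Rmult_le_compat_r; [lra|]. apply Rmult_le_compat_r; lra. }
    assert (q * (h * eps * (E x u - exp (A * r0))) <= q * (h * eps * E x u)).
    { apply Rmult_le_compat_l; [lra|]. apply Rmult_le_compat_l; lra. }
    assert ((C * B + q) * (h * eps * E x u) <= A ^ 2 * (h * eps * E x u))
      by (apply Rmult_le_compat_r; lra).
    lra. }
eapply Rle_trans; [|exact Hz].
rewrite <- Rmult_assoc. apply Rmult_le_compat_l; [nra|].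
assert (exp (2 * A * r0) <= E r sb).
{ apply exp_le. fold d. assert (B * d = 2 * A * r0) by (unfold B; field; lra).
  assert (0 <= A * r) by (apply Rmult_le_pos; lra). lra. }
lra.
Qed.

(** A barrier constant in [r] asks of the boundary only that [sigma] does not decrease. The rate is
    [C = q exp (2 M)]: since [c >= exp (- (2 M))], this gives [c C >= q]. *)
Lemma log_flow_persistence r0 s0 s1 sigma G Gr Gs Grr M S sa sb h0 mu :
  log_flow r0 s0 s1 sigma G Gr Gs Grr -> 0 < r0 -> 0 <= sigma s0 ->
  (forall s s', s0 <= s <= s' -> s' < s1 -> sigma s <= sigma s') ->
  S < s1 ->
  (forall r s, 0 <= r <= r0 -> s0 <= s <= S ->
    - M <= G r s <= M /\ Rabs (Gs r s + 1) <= M + 1) ->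
  s0 <= sa <= sb -> sb + h0 <= S -> 0 < mu ->
  (forall r h, 0 <= r <= r0 -> 0 < h < h0 -> h * mu <= G r (sa + h) - G r sa) ->
  exists nu, 0 < nu /\
    forall r h, 0 <= r <= r0 -> 0 < h < h0 -> h * nu <= G r (sb + h) - G r sb.
Proof.
intros lf Hr0 Hs0 Hmono HS Hb Hsab HsbS Hmu Hinit.
set (q := 2 * exp (2 * M) * (M + 1)) in *.
set (C := q * exp (2 * M)).
exists (mu * exp (- C * (sb - sa))). split.
{ pose proof (exp_pos (- C * (sb - sa))). nra. }
intros r h Hr Hh.
rewrite <- Rmult_assoc.
apply (log_flow_barrier r0 s0 s1 sigma G Gr Gs Grr M S sa sb h
    (fun r s => h * mu * exp (- C * (s - sa))) (fun r s => 0)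
    (fun r s => - C * (h * mu * exp (- C * (s - sa)))) (fun r s => 0));
    try assumption; try lra; fold q.
- intros x u. apply continuity_2d_pt_mult; [apply continuity_2d_pt_const|].
  apply (continuity_1d_2d_pt_comp exp).
  + apply derivable_continuous_pt, derivable_pt_exp.
  + apply continuity_2d_pt_mult; [apply continuity_2d_pt_const|].
    apply continuity_2d_pt_minus; [apply continuity_2d_pt_id2|apply continuity_2d_pt_const].
- intros x u. auto_derive; [exact I|ring].
- intros x u. auto_derive; [exact I|]. unfold Rminus; ring.
- intros x u. auto_derive; [exact I|ring].
- intros x Hx. replace (- C * (sa - sa)) with 0 by ring. rewrite exp_0, Rmult_1_r. auto.
- intros; lra.
- intros u Hu. specialize (Hmono u (u + h) ltac:(lra) ltac:(lra)).
  apply Rmult_le_pos; [left; apply exp_pos|lra].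
- intros x u c Hx Hu Hzp Hc.
  assert (Hq : 0 <= q).
  { destruct (Hb x u ltac:(lra) ltac:(lra)) as [_ H]. pose proof (Rabs_pos (Gs x u + 1)).
    unfold q. pose proof (exp_pos (2 * M)). apply Rmult_le_pos; lra. }
  set (z := h * mu * exp (- C * (u - sa))) in *.
  assert (HcC : q <= c * C).
  { apply Rle_trans with (exp (- (2 * M)) * C).
    - unfold C. right.
      replace (exp (- (2 * M)) * (q * exp (2 * M)))
        with (q * (exp (- (2 * M)) * exp (2 * M))) by ring.
      rewrite <- exp_plus, Rplus_opp_l, exp_0. ring.
    - apply Rmult_le_compat_r; [|lra]. unfold C. pose proof (exp_pos (2 * M)). nra. }
  assert (q * z <= c * C * z) by (apply Rmult_le_compat_r; lra). lra.
Qed.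

(** Growth of [sigma] is required before every time [e], because strictness is claimed right after
    [s0]. The bound [mu] is uniform in [r] so that it survives the limit [r -> 0] defining the
    curvature at the origin. *)
Theorem log_flow_strictly_increasing r0 s0 s1 sigma G Gr Gs Grr :
  log_flow r0 s0 s1 sigma G Gr Gs Grr -> 0 < r0 -> 0 <= sigma s0 ->
  (forall s s', s0 <= s <= s' -> s' < s1 -> sigma s <= sigma s') ->
  (forall e, s0 < e < s1 -> exists sa sc gam, s0 <= sa < sc /\ sc <= e /\ 0 < gam /\
    forall s h, sa <= s -> 0 < h -> s + h <= sc -> gam * h <= sigma (s + h) - sigma s) ->
  (forall r s, 0 <= r <= r0 -> s0 <= s < s1 -> 0 <= Gs r s) /\
  (forall s, s0 < s < s1 -> exists mu, 0 < mu /\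
    forall r, 0 <= r <= r0 -> mu <= Gs r s).
Proof.
intros lf Hr0 Hs0 Hmono Hgrow. split.
- intros r s Hr Hs.
  apply (is_derive_right_ge (fun u => G r u) s _ _ (s1 - s)); [|lra|].
  + apply (lf_ds lf); lra.
  + intros h Hh.
    assert (G r s <= G r (s + h))
      by (apply (log_flow_monotone _ _ _ _ _ _ _ _ lf); auto; lra).
    lra.
- intros s Hs.
  set (S := (s + s1) / 2). assert (HS : s < S < s1) by (unfold S; lra).
  destruct (log_flow_bounds _ _ _ _ _ _ _ _ S lf ltac:(lra)) as (M & HM & Hb).
  destruct (Hgrow s Hs) as (sa & sc & gam & Hsa & Hsc & Hgam & Hg).
  set (sb := (sa + sc) / 2). assert (Hsb : sa < sb < sc) by (unfold sb; lra).
  (* Ignition uses only [[sa, sb]], half of the growth interval, so that translates by less than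
     [h0] stay below [sc]; those of [[sb, s]] stay below [S]. *)
  set (h0 := Rmin (S - s) (sc - sb)).
  assert (Hh0 : 0 < h0) by (apply Rmin_pos; lra).
  assert (Hh1 : h0 <= S - s) by apply Rmin_l.
  assert (Hh2 : h0 <= sc - sb) by apply Rmin_r.
  destruct (log_flow_ignition _ _ _ _ _ _ _ _ M S sa sb h0 gam lf) as (mu & Hmu & Hmu');
    try assumption; try lra.
  { intros; apply Hg; lra. }
  destruct (log_flow_persistence _ _ _ _ _ _ _ _ M S sb s h0 mu lf) as (nu & Hnu & Hnu');
    try assumption; try lra.
  exists nu. split; [assumption|]. intros r Hr.
  apply (is_derive_right_ge (fun u => G r u) s _ _ h0); [|lra|].
  + apply (lf_ds lf); lra.
  + intros h Hh. auto.
Qed.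

(** * Change of time and the boundary data *)

(** The mean value theorem finds a point with [f' > 0], and continuity keeps [f'] above half that
    value just to its right. *)
Lemma growth_interval (f f' : R -> R) (s0 sp : R) :
  s0 < sp -> (forall s, s0 <= s <= sp -> is_derive f s (f' s)) ->
  (forall s, s0 <= s <= sp -> continuity_pt f' s) -> f s0 < f sp ->
  exists sa sc gam, s0 <= sa < sc /\ sc <= sp /\ 0 < gam /\
    forall s h, sa <= s -> 0 < h -> s + h <= sc -> gam * h <= f (s + h) - f s.
Proof.
intros Hsp Hd Hc Hlt.
destruct (MVT_cor2 f f' s0 sp Hsp) as [c [Hc1 Hc2]].
{ intros c Hc'. apply is_derive_Reals, Hd; lra. }
assert (Hpos : 0 < f' c) by nra.
assert (Hp2 : 0 < f' c / 2) by lra.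
destruct (proj1 (continuity_pt_locally f' c) (Hc c ltac:(lra)) (mkposreal _ Hp2)) as [d Hdd].
simpl in Hdd. pose proof (cond_pos d).
exists c, (Rmin (c + d / 2) sp), (f' c / 2).
pose proof (Rmin_l (c + d / 2) sp). pose proof (Rmin_r (c + d / 2) sp).
assert (c < Rmin (c + d / 2) sp) by (apply Rmin_glb_lt; lra).
repeat split; try lra. intros s h Hs Hh Hsh.
destruct (MVT_cor2 f f' s (s + h) ltac:(lra)) as [z [Hz1 Hz2]].
{ intros z Hz. apply is_derive_Reals, Hd; lra. }
assert (Hz : Rabs (f' z - f' c) < f' c / 2).
{ apply (Hdd z). apply Rabs_lt_between'. lra. }
apply Rabs_def2 in Hz. rewrite Hz1. replace (s + h - s) with h by ring.
apply Rmult_le_compat_r; lra.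
Qed.

(* [flow_time] is the inverse of the time change [ds = dt / xi], which makes the
   equation for [a ^ 2 / xi] autonomous. *)
Definition flow_time (m s : R) : R := ln (exp (2 * s) + 1 - m) / 2.
Definition flow_clock (m t : R) : R := ln (exp (2 * t) + m - 1) / 2.

Lemma exp_double_half_ln (x : R) : 0 < x -> exp (2 * (ln x / 2)) = x.
Proof. intros Hx. replace (2 * (ln x / 2)) with (ln x) by field. now apply exp_ln. Qed.

Lemma xi_pos (m t : R) : 0 < m -> 0 <= t -> 0 < xi m t.
Proof.
intros Hm Ht. unfold xi. pose proof (exp_pos (-2 * t)).
assert (exp (-2 * t) <= 1) by (rewrite <- exp_0; apply exp_le; lra). nra.
Qed.

(** From the initial clock time [ln m / 2] on, the argument of [ln] in [flow_time] is thus at least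
    1. *)
Lemma exp_double_ge (m s : R) : 0 < m -> ln m / 2 <= s -> m <= exp (2 * s).
Proof.
intros Hm Hs. rewrite <- (exp_double_half_ln m Hm) at 1. apply exp_le; lra.
Qed.

Lemma exp_flow_time (m s : R) :
  0 < m -> ln m / 2 <= s -> exp (2 * flow_time m s) = exp (2 * s) + 1 - m.
Proof.
intros Hm Hs. pose proof (exp_double_ge m s Hm Hs). apply exp_double_half_ln; lra.
Qed.

Lemma flow_time_nonneg (m s : R) : 0 < m -> ln m / 2 <= s -> 0 <= flow_time m s.
Proof.
intros Hm Hs. pose proof (exp_double_ge m s Hm Hs). pose proof (exp_flow_time m s Hm Hs).
apply Rnot_lt_le; intros Hn.
assert (exp (2 * flow_time m s) < 1) by (rewrite <- exp_0; apply exp_increasing; lra). lra.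
Qed.

Lemma exp_double_pos (m t : R) : 0 < m -> 0 <= t -> 0 < exp (2 * t) + m - 1.
Proof.
intros Hm Ht. assert (exp 0 <= exp (2 * t)) by (apply exp_le; lra).
rewrite exp_0 in H. lra.
Qed.

Lemma flow_time_flow_clock (m t : R) : 0 < m -> 0 <= t -> flow_time m (flow_clock m t) = t.
Proof.
intros Hm Ht. unfold flow_time, flow_clock.
rewrite exp_double_half_ln by now apply exp_double_pos.
replace (exp (2 * t) + m - 1 + 1 - m) with (exp (2 * t)) by ring.
rewrite ln_exp. field.
Qed.

Lemma flow_clock_flow_time (m s : R) : 0 < m -> ln m / 2 <= s -> flow_clock m (flow_time m s) = s.
Proof.
intros Hm Hs. unfold flow_clock. rewrite exp_flow_time by assumption.
replace (exp (2 * s) + 1 - m + m - 1) with (exp (2 * s)) by ring.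
rewrite ln_exp. field.
Qed.

Lemma flow_clock_0 (m : R) : 0 < m -> flow_clock m 0 = ln m / 2.
Proof.
intros Hm. unfold flow_clock. rewrite Rmult_0_r, exp_0. f_equal. f_equal. ring.
Qed.

Lemma flow_clock_lt (m t u : R) : 0 < m -> 0 <= t < u -> flow_clock m t < flow_clock m u.
Proof.
intros Hm Htu. unfold flow_clock. apply Rmult_lt_compat_r; [lra|].
apply ln_increasing; [apply exp_double_pos; lra|].
assert (exp (2 * t) < exp (2 * u)) by (apply exp_increasing; lra). lra.
Qed.

Lemma flow_time_lt (m s t : R) :
  0 < m -> 0 <= t -> ln m / 2 <= s < flow_clock m t -> flow_time m s < t.
Proof.
intros Hm Ht Hs. apply Rnot_le_lt; intros Hn.
destruct (Req_dec t (flow_time m s)) as [He|He].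
- rewrite He, flow_clock_flow_time in Hs; lra.
- assert (flow_clock m t < flow_clock m (flow_time m s)) by (apply flow_clock_lt; lra).
  rewrite flow_clock_flow_time in H; lra.
Qed.

(** With [t = flow_time m s], the relation [exp (2 s) = exp (2 t) + m - 1] says
    [exp (2 s) = exp (2 t) xi]. Hence [exp (s - t)] serves as [sqrt xi] below. *)
Lemma xi_flow_time (m s : R) :
  0 < m -> ln m / 2 <= s -> xi m (flow_time m s) = exp (s - flow_time m s) ^ 2.
Proof.
intros Hm Hs. pose proof (exp_flow_time m s Hm Hs). pose proof (exp_pos (2 * flow_time m s)).
replace (exp (s - flow_time m s) ^ 2) with (exp (2 * s + - (2 * flow_time m s)))
  by (simpl; rewrite Rmult_1_r, <- exp_plus; f_equal; ring).
unfold xi. replace (-2 * flow_time m s) with (- (2 * flow_time m s)) by ring.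
rewrite exp_plus, exp_Ropp. apply Rmult_eq_reg_r with (exp (2 * flow_time m s)); [|lra].
field_simplify; lra.
Qed.

Lemma is_derive_flow_time (m s : R) :
  0 < m -> ln m / 2 <= s -> is_derive (flow_time m) s (xi m (flow_time m s)).
Proof.
intros Hm Hs. pose proof (exp_double_ge m s Hm Hs). pose proof (exp_flow_time m s Hm Hs).
unfold flow_time at 1. auto_derive; [lra|].
unfold xi. replace (-2 * flow_time m s) with (- (2 * flow_time m s)) by ring.
rewrite exp_Ropp, H0. field. lra.
Qed.

Lemma continuity_pt_flow_time (m s : R) :
  0 < m -> ln m / 2 <= s -> continuity_pt (flow_time m) s.
Proof.
intros Hm Hs. apply derivable_continuous_pt. exists (xi m (flow_time m s)).
apply is_derive_Reals. now apply is_derive_flow_time.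
Qed.

(** The product [sqrt xi * rho] in the new time, in a form that differentiates without square
    roots. *)
Definition scaled_rho (m : R) (rho : R -> R) (s : R) : R :=
  exp (s - flow_time m s) * rho (flow_time m s).
Definition dscaled_rho (m : R) (rho : R -> R) (s : R) : R :=
  exp (s - flow_time m s) *
    ((1 - xi m (flow_time m s)) * rho (flow_time m s) +
     xi m (flow_time m s) * Derive rho (flow_time m s)).

Lemma is_derive_scaled_rho (m : R) (rho : R -> R) (s : R) :
  0 < m -> ln m / 2 <= s -> (forall t, ex_derive rho t) ->
  is_derive (scaled_rho m rho) s (dscaled_rho m rho s).
Proof.
intros Hm Hs Hrho. pose proof (is_derive_flow_time m s Hm Hs) as Ht.
assert (HD : Derive (fun z => flow_time m z) s = xi m (flow_time m s))
  by now apply is_derive_unique.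
unfold scaled_rho, dscaled_rho. auto_derive.
- repeat split; try apply Hrho; exists (xi m (flow_time m s)); exact Ht.
- rewrite HD. change (Derive (fun x => rho x)) with (Derive rho). unfold Rminus. ring.
Qed.

Lemma continuity_pt_dscaled_rho (m : R) (rho : R -> R) (s : R) :
  0 < m -> ln m / 2 <= s -> (forall t, ex_derive rho t) ->
  (forall t, ex_derive (Derive rho) t) -> continuity_pt (dscaled_rho m rho) s.
Proof.
intros Hm Hs Hrho Hrho'. pose proof (is_derive_flow_time m s Hm Hs) as Ht.
apply continuity_pt_filterlim. apply (ex_derive_continuous (dscaled_rho m rho)).
set (rho1 := Derive rho) in *. unfold dscaled_rho. fold rho1. clearbody rho1. unfold xi.
auto_derive. repeat split; try apply Hrho; try apply Hrho'; exists (xi m (flow_time m s)); exact Ht.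
Qed.

(** The mean value theorem, started from [rho 0 = 0], passes the sign of the derivative on to [rho].
    The second derivative, available since [k >= 2], serves the continuity of [dscaled_rho]. *)
Lemma rho_hyp_nonneg (k : nat) (m : R) (rho : R -> R) :
  (2 <= k)%nat -> rho_hyp k m rho ->
  (forall t, ex_derive rho t) /\ (forall t, ex_derive (Derive rho) t) /\
  (forall t, 0 <= t -> 0 <= rho t) /\
  exists t1, 0 < t1 /\ forall t, 0 < t < t1 -> 0 < rho t.
Proof.
intros Hk (Hd & _ & H0 & _ & Hpos & (t1 & Ht1 & Hp1) & _).
assert (Hd1 : forall t, ex_derive rho t) by (intros t; apply (Hd 1%nat); lia).
assert (Hd2 : forall t, ex_derive (Derive rho) t) by (intros t; apply (Hd 2%nat); lia).
assert (Hmvt : forall t, 0 < t -> exists c, rho t = Derive rho c * t /\ 0 < c < t).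
{ intros t Ht. destruct (MVT_cor2 rho (Derive rho) 0 t Ht) as [c [Hc1 Hc2]].
  - intros c _. apply is_derive_Reals, Derive_correct, Hd1.
  - exists c. split; [|exact Hc2]. lra. }
split; [exact Hd1|]. split; [exact Hd2|]. split.
- intros t Ht. destruct (Req_dec t 0) as [->|]; [lra|].
  destruct (Hmvt t ltac:(lra)) as (c & -> & Hc). specialize (Hpos c ltac:(lra)). nra.
- exists t1. split; [exact Ht1|]. intros t Ht.
  destruct (Hmvt t ltac:(lra)) as (c & -> & Hc). specialize (Hp1 c ltac:(lra)). nra.
Qed.

(** For [m <= 1] one has [xi <= 1] and both terms are nonnegative. For [m > 1] the first term may be
    negative, and the extra hypothesis on [rho], multiplied by [xi], is exactly the claim. *)
Lemma dscaled_rho_nonneg (k : nat) (m : R) (rho : R -> R) (s : R) :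
  (2 <= k)%nat -> 0 < m -> rho_hyp k m rho -> ln m / 2 <= s ->
  0 <= dscaled_rho m rho s.
Proof.
intros Hk Hm Hrho Hs.
destruct (rho_hyp_nonneg k m rho Hk Hrho) as (_ & _ & Hr & _).
destruct Hrho as (_ & _ & _ & _ & Hpos & _ & Hm1).
pose proof (flow_time_nonneg m s Hm Hs) as Ht. pose proof (xi_pos m _ Hm Ht) as Hxi.
specialize (Hr _ Ht). specialize (Hpos _ Ht).
apply Rmult_le_pos; [left; apply exp_pos|].
destruct (Rle_lt_dec m 1) as [Hle|Hlt].
- assert (xi m (flow_time m s) <= 1).
  { unfold xi. pose proof (exp_pos (-2 * flow_time m s)). nra. }
  assert (0 <= (1 - xi m (flow_time m s)) * rho (flow_time m s)) by (apply Rmult_le_pos; lra).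
  assert (0 <= xi m (flow_time m s) * Derive rho (flow_time m s)) by (apply Rmult_le_pos; lra). lra.
- specialize (Hm1 Hlt _ Ht).
  apply (Rmult_le_compat_l (xi m (flow_time m s))) in Hm1; [|lra].
  replace (xi m (flow_time m s) * ((1 - / xi m (flow_time m s)) * rho (flow_time m s)))
    with ((xi m (flow_time m s) - 1) * rho (flow_time m s)) in Hm1 by (field; lra).
  lra.
Qed.

Lemma scaled_rho_monotone (k : nat) (m : R) (rho : R -> R) (s s' : R) :
  (2 <= k)%nat -> 0 < m -> rho_hyp k m rho -> ln m / 2 <= s <= s' ->
  scaled_rho m rho s <= scaled_rho m rho s'.
Proof.
intros Hk Hm Hrho Hs.
destruct (rho_hyp_nonneg k m rho Hk Hrho) as (Hd & _).
destruct (Req_dec s s') as [->|Hne]; [lra|].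
destruct (MVT_cor2 (scaled_rho m rho) (dscaled_rho m rho) s s') as [c [Hc1 Hc2]]; [lra| |].
- intros c Hc. apply is_derive_Reals, is_derive_scaled_rho; try assumption; lra.
- assert (0 <= dscaled_rho m rho c) by (apply (dscaled_rho_nonneg k); try assumption; lra).
  nra.
Qed.

Lemma scaled_rho_growth (k : nat) (m : R) (rho : R -> R) (e : R) :
  (2 <= k)%nat -> 0 < m -> rho_hyp k m rho -> ln m / 2 < e ->
  exists sa sc gam, ln m / 2 <= sa < sc /\ sc <= e /\ 0 < gam /\
    forall s h, sa <= s -> 0 < h -> s + h <= sc ->
      gam * h <= scaled_rho m rho (s + h) - scaled_rho m rho s.
Proof.
intros Hk Hm Hrho He.
destruct (rho_hyp_nonneg k m rho Hk Hrho) as (Hd & Hd2 & _ & t1 & Ht1 & Hpos).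
assert (H0 : rho 0 = 0) by apply Hrho.
assert (Hte : 0 < flow_time m e).
{ destruct (flow_time_nonneg m e Hm ltac:(lra)) as [|Hz]; [assumption|].
  assert (Hse := flow_clock_flow_time m e Hm ltac:(lra)). rewrite <- Hz, flow_clock_0 in Hse; lra. }
(* Below [t1] the function [rho] is positive, so [scaled_rho] rises above its initial value 0; below
   [flow_time m e] this happens before clock time [e]. *)
set (t := Rmin t1 (flow_time m e) / 2).
assert (Ht : 0 < t /\ t < t1 /\ t < flow_time m e).
{ pose proof (Rmin_l t1 (flow_time m e)). pose proof (Rmin_r t1 (flow_time m e)).
  assert (0 < Rmin t1 (flow_time m e)) by (apply Rmin_pos; lra). unfold t; lra. }
assert (Hlo : ln m / 2 < flow_clock m t)
  by (rewrite <- flow_clock_0 by assumption; apply flow_clock_lt; lra).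
assert (Hhi : flow_clock m t < e).
{ rewrite <- (flow_clock_flow_time m e) by lra. apply flow_clock_lt; lra. }
destruct (growth_interval (scaled_rho m rho) (dscaled_rho m rho) (ln m / 2) (flow_clock m t))
  as (sa & sc & gam & H1 & H2 & H3 & H4); [assumption| | | |].
- intros s Hs. apply is_derive_scaled_rho; try assumption; lra.
- intros s Hs. apply continuity_pt_dscaled_rho; try assumption; lra.
- unfold scaled_rho. rewrite flow_time_flow_clock by lra.
  rewrite <- (flow_clock_0 m) by assumption.
  rewrite flow_time_flow_clock by lra.
  rewrite H0, Rmult_0_r.
  apply Rmult_lt_0_compat; [apply exp_pos|apply Hpos; lra].
- exists sa, sc, gam. repeat split; try assumption; lra.
Qed.

(** * Reduction of the geometric flow *)

Lemma sinh_pos (r : R) : 0 < r -> 0 < sinh r.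
Proof. intros Hr. rewrite <- sinh_0. now apply sinh_lt. Qed.

(** At fixed [r > 0] both [a] and [b] solve the same linear equation in time, so [b / a] keeps its
    initial value [sinh r]. At the origin both sides vanish. *)
Lemma sym_solution_conformal m r0 etaf T a b r t :
  0 < m -> is_sym_solution m r0 etaf T a b ->
  0 <= r <= r0 -> 0 <= t < T -> b r t = a r t * sinh r.
Proof.
intros Hm (Hreg & Ha & Hb & Ho & Hpde & _ & Hi) Hr Ht.
assert (Hsm := sqrt_lt_R0 m Hm).
destruct (Req_dec r 0) as [->|Hr0].
{ rewrite sinh_0, Rmult_0_r. now apply Ho. }
destruct (Req_dec t 0) as [->|Ht0].
{ destruct (Hi r Hr) as [-> ->]. ring. }
destruct (MVT_cor2 (fun u => b r u / a r u) (fun _ => 0) 0 t) as [c [Hc _]]; [lra| |].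
{ intros c Hc. apply is_derive_Reals.
  destruct (Hpde r c ltac:(lra) ltac:(lra)) as [E1 E2].
  destruct (Hreg r c ltac:(lra)) as (_ & _ & _ & D1 & D2 & _).
  assert (Hac := Ha r c Hr ltac:(lra)).
  unfold d_t in E1, E2. auto_derive; [repeat split; try assumption; lra|].
  change (fun x => a r x) with (a r) in *. change (fun x => b r x) with (b r) in *.
  rewrite E1, E2. field. lra. }
destruct (Hi r Hr) as [A0 B0]. simpl in Hc. rewrite A0, B0 in Hc.
assert (Hac := Ha r t Hr ltac:(lra)).
replace (b r t) with (b r t / a r t * a r t) by (field; lra).
replace (b r t / a r t) with (sinh r); [ring|].
replace (sqrt m * sinh r / sqrt m) with (sinh r) in Hc by (field; lra). lra.
Qed.

Lemma sym_solution_ds_b m r0 etaf T a b r t :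
  0 < m -> is_sym_solution m r0 etaf T a b ->
  0 < r <= r0 -> 0 <= t < T ->
  ds_b a b r t = sinh r * (d_r a r t / a r t) + cosh r.
Proof.
intros Hm Hsol Hr Ht.
assert (Hconf := fun x => sym_solution_conformal m r0 etaf T a b x t Hm Hsol).
destruct Hsol as (Hreg & Ha & _).
assert (Hac := Ha r t ltac:(lra) Ht).
destruct (Hreg r t ltac:(lra)) as (D1 & D2 & _).
assert (He : d_r b r t = d_r a r t * sinh r + a r t * cosh r).
{ apply (is_derive_eq_left (fun x => b x t) (fun x => a x t * sinh x) r _ _ r).
  - now apply Derive_correct.
  - apply (is_derive_mult (fun x => a x t) sinh).
    + now apply Derive_correct.
    + apply is_derive_Reals, derivable_pt_lim_sinh.
    + intros; apply Rmult_comm.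
  - lra.
  - intros y Hy. apply Hconf; lra. }
unfold ds_b. rewrite He. field. lra.
Qed.

(** This is [log (a / sqrt xi)], with [sqrt xi] written as [exp (s - t)]. *)
Definition flowG (m : R) (a : R -> R -> R) (r s : R) : R :=
  ln (a r (flow_time m s)) - s + flow_time m s.
Definition flowGr (m : R) (a : R -> R -> R) (r s : R) : R :=
  d_r a r (flow_time m s) / a r (flow_time m s).
Definition flowGs (m : R) (a : R -> R -> R) (r s : R) : R :=
  xi m (flow_time m s) * (d_t a r (flow_time m s) / a r (flow_time m s) + 1) - 1.
(** The regularity hypotheses provide a derivative of [ds_b], not a second derivative of [a]. This
    formula results from solving [ds_b = sinh r Gr + cosh r] for [Gr] and differentiating. *)
Definition flowGrr (m : R) (a b : R -> R -> R) (r s : R) : R :=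
  Derive (fun x => ds_b a b x (flow_time m s)) r / sinh r - 1 - cosh r / sinh r * flowGr m a r s.

Lemma jcont_comp_flow_time m f r s :
  0 < m -> ln m / 2 <= s -> jcont f r (flow_time m s) ->
  continuity_2d_pt (fun x u => f x (flow_time m u)) r s.
Proof.
intros Hm Hs Hf. apply continuity_2d_pt_comp_r; [|now apply continuity_pt_flow_time].
apply continuity_2d_pt_filterlim. exact Hf.
Qed.

Lemma continuity_2d_pt_snd (f : R -> R) (x y : R) :
  continuity_pt f y -> continuity_2d_pt (fun _ v => f v) x y.
Proof.
intros Hf. apply (continuity_1d_2d_pt_comp f (fun _ v => v)); [exact Hf|].
apply continuity_2d_pt_id2.
Qed.

Lemma sym_solution_log_flow m r0 rho T a b :
  0 < r0 -> 0 < m -> 0 < T -> is_sym_solution m r0 (eta m r0 rho) T a b ->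
  log_flow r0 (ln m / 2) (flow_clock m T) (scaled_rho m rho)
    (flowG m a) (flowGr m a) (flowGs m a) (flowGrr m a b).
Proof.
intros Hr0 Hm HT Hsol.
assert (Htt : forall s, ln m / 2 <= s < flow_clock m T -> 0 <= flow_time m s < T).
{ intros s Hs. split; [apply flow_time_nonneg; lra|apply flow_time_lt; lra]. }
assert (Hconf := fun x t => sym_solution_conformal m r0 _ T a b x t Hm Hsol).
assert (Hds := fun x t => sym_solution_ds_b m r0 _ T a b x t Hm Hsol).
destruct Hsol as (Hreg & Ha & Hb & Ho & Hpde & Hbd & Hi).
assert (Hdxi : forall s, ln m / 2 <= s ->
  ex_derive (flow_time m) s /\ Derive (flow_time m) s = xi m (flow_time m s)).
{ intros s Hs. assert (H := is_derive_flow_time m s Hm Hs).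
  split; [now exists (xi m (flow_time m s))|now apply is_derive_unique]. }
assert (Hexp : forall r s, 0 <= r <= r0 -> ln m / 2 <= s < flow_clock m T ->
  exp (flowG m a r s) = a r (flow_time m s) / exp (s - flow_time m s)).
{ intros r s Hr Hs. unfold flowG.
  replace (ln (a r (flow_time m s)) - s + flow_time m s)
    with (ln (a r (flow_time m s)) + - (s - flow_time m s)) by ring.
  rewrite exp_plus, exp_Ropp, exp_ln by (apply Ha; auto). reflexivity. }
split.
- intros r s Hr Hs. destruct (Hreg r (flow_time m s) ltac:(apply Htt; lra))
    as (_ & _ & _ & _ & _ & C1 & _).
  unfold flowG. apply continuity_2d_pt_plus; [apply continuity_2d_pt_minus|].
  + apply (continuity_1d_2d_pt_comp ln).
    * apply derivable_continuous_pt. exists (/ a r (flow_time m s)).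
      apply derivable_pt_lim_ln. apply Ha; auto.
    * apply jcont_comp_flow_time; try assumption; lra.
  + apply continuity_2d_pt_id2.
  + apply continuity_2d_pt_snd, continuity_pt_flow_time; lra.
- intros r s Hr Hs.
  destruct (Hreg r (flow_time m s) ltac:(apply Htt; lra)) as
    (_ & _ & _ & _ & _ & C1 & _ & _ & _ & _ & C2 & _).
  specialize (Ha r (flow_time m s) Hr (Htt s Hs)).
  unfold flowGs. apply continuity_2d_pt_minus; [|apply continuity_2d_pt_const].
  apply continuity_2d_pt_mult.
  + apply (continuity_2d_pt_snd (fun u => xi m (flow_time m u))).
    apply continuity_pt_filterlim.
    apply (ex_derive_continuous (fun u => xi m (flow_time m u))). unfold xi. auto_derive.
    repeat split. apply Hdxi; lra.
  + apply continuity_2d_pt_plus; [|apply continuity_2d_pt_const].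
    unfold Rdiv. apply continuity_2d_pt_mult; [|apply continuity_2d_pt_inv; [|lra]];
      apply jcont_comp_flow_time; try assumption; lra.
- intros r s Hr Hs. destruct (Hreg r (flow_time m s) ltac:(apply Htt; lra)) as (D1 & _).
  specialize (Ha r (flow_time m s) Hr (Htt s Hs)).
  unfold flowG, flowGr, d_r. auto_derive; [now split|].
  field. lra.
- intros r s Hr Hs. destruct (Hreg r (flow_time m s) ltac:(apply Htt; lra)) as (_ & _ & _ & D1 & _).
  specialize (Ha r (flow_time m s) Hr (Htt s Hs)).
  destruct (Hdxi s ltac:(lra)) as [E1 E2].
  unfold flowG, flowGs, d_t. auto_derive; [now repeat split|].
  change (fun x => flow_time m x) with (flow_time m). rewrite E2. field. lra.
- intros r s Hr Hs.
  destruct (Hreg r (flow_time m s) ltac:(apply Htt; lra)) as (_ & _ & D3 & _).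
  assert (Hsr := sinh_pos r ltac:(lra)).
  apply (is_derive_ext_loc
    (fun x => (ds_b a b x (flow_time m s) - cosh x) / sinh x)).
  { assert (Hd : 0 < Rmin r (r0 - r)) by (apply Rmin_pos; lra).
    exists (mkposreal _ Hd). intros x Hx.
    change (Rabs (x - r) < Rmin r (r0 - r)) in Hx. apply Rabs_def2 in Hx.
    pose proof (Rmin_l r (r0 - r)). pose proof (Rmin_r r (r0 - r)).
    rewrite Hds by (try apply Htt; lra). unfold flowGr.
    match goal with |- ?u = ?v => change (@eq R u v) end. field.
    split; [specialize (Ha x (flow_time m s) ltac:(lra) (Htt s Hs)); lra|].
    assert (Hsx := sinh_pos x ltac:(lra)). lra. }
  assert (Hgr : flowGr m a r s = (ds_b a b r (flow_time m s) - cosh r) / sinh r).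
  { rewrite Hds by (try apply Htt; lra). unfold flowGr. field.
    split; [|lra]. specialize (Ha r (flow_time m s) ltac:(lra) (Htt s Hs)); lra. }
  unfold flowGrr. rewrite Hgr.
  evar_last.
  + apply (is_derive_div (fun x => ds_b a b x (flow_time m s) - cosh x) sinh).
    * apply (is_derive_minus (fun x => ds_b a b x (flow_time m s)) cosh).
      -- apply Derive_correct; exact D3.
      -- apply is_derive_Reals, derivable_pt_lim_cosh.
    * apply is_derive_Reals, derivable_pt_lim_sinh.
    * lra.
  + unfold minus, plus, opp; simpl.
    match goal with |- ?u = ?v => change (@eq R u v) end. field. lra.
- intros r s Hr Hs.
  assert (Hsr := sinh_pos r ltac:(lra)).
  assert (Hac := Ha r (flow_time m s) ltac:(lra) (Htt s Hs)).
  pose proof (exp_pos (s - flow_time m s)).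
  destruct (Hpde r (flow_time m s) ltac:(lra) (Htt s Hs)) as [E1 _].
  (* Both sides equal [- K a ^ 2]: on the left [exp (2 G) = a ^ 2 / xi] and [Gs + 1 = - xi K], on
     the right only the derivative of [ds_b] over [sinh r] remains. *)
  replace (exp (2 * flowG m a r s)) with (exp (flowG m a r s) * exp (flowG m a r s))
    by (rewrite <- exp_plus; f_equal; ring).
  rewrite Hexp by lra. unfold flowGrr, flowGs. rewrite E1, xi_flow_time by lra.
  unfold gaussK, dss_b. rewrite Hconf by (try apply Htt; lra).
  field. lra.
- intros s Hs. destruct (Ho (flow_time m s) (Htt s Hs)) as (_ & _ & E & _).
  unfold flowGr. rewrite E. unfold Rdiv; ring.
- intros s Hs.
  assert (Hsr := sinh_pos r0 Hr0).
  assert (Hac := Ha r0 (flow_time m s) ltac:(lra) (Htt s Hs)).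
  pose proof (exp_pos (s - flow_time m s)).
  specialize (Hbd (flow_time m s) (Htt s Hs)).
  unfold geodK, eta in Hbd. rewrite Hds, Hconf in Hbd by (try apply Htt; lra).
  rewrite xi_flow_time, sqrt_pow2 in Hbd by lra.
  rewrite Hexp by lra. unfold scaled_rho.
  (* Multiplied by [a], the condition on the geodesic curvature reads
     [Gr + coth r0 = exp G (coth r0 + sigma)], because [exp G = a / sqrt xi]. *)
  apply (f_equal (fun z => z * a r0 (flow_time m s))) in Hbd.
  fold (flowGr m a r0 s) in Hbd.
  replace (flowGr m a r0 s) with
   ((sinh r0 * flowGr m a r0 s + cosh r0) / (a r0 (flow_time m s) * sinh r0) * a r0 (flow_time m s)
      - cosh r0 / sinh r0) by (field; lra).
  rewrite Hbd. field. lra.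
- intros r Hr. unfold flowG. rewrite <- (flow_clock_0 m) by assumption.
  rewrite flow_time_flow_clock by lra.
  destruct (Hi r Hr) as [-> _]. rewrite flow_clock_0 by assumption.
  replace (ln m) with (ln (sqrt m * sqrt m)) by (rewrite sqrt_sqrt by lra; reflexivity).
  rewrite ln_mult by (now apply sqrt_lt_R0). field.
Qed.

(** * The sign of [F_1], including the origin *)

Theorem theorem6p1 (r0 : R) (k : nat) (m : R) (rho : R -> R) (T : R)
  (a b : R -> R -> R) :
  0 < r0 -> (2 <= k)%nat -> 0 < m -> m <> 1 ->
  rho_hyp k m rho ->
  0 < T ->
  is_sym_solution m r0 (eta m r0 rho) T a b ->
  (* F_1 = K_{g(t)} + xi(t)^{-1} away from the origin *)
  (forall r t, 0 < r <= r0 -> 0 <= t < T ->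
     gaussK a b r t + / xi m t <= 0 /\
     (0 < t -> gaussK a b r t + / xi m t < 0)) /\
  (* F_1 at the origin, where K_{g(t)} is the limit of K as r -> 0+ *)
  (forall t K0, 0 <= t < T ->
     filterlim (fun r => gaussK a b r t) (at_right 0) (locally K0) ->
     K0 + / xi m t <= 0 /\ (0 < t -> K0 + / xi m t < 0)).
Proof.
intros Hr0 Hk Hm _ Hrho HT Hsol.
assert (lf := sym_solution_log_flow m r0 rho T a b Hr0 Hm HT Hsol).
destruct (log_flow_strictly_increasing _ _ _ _ _ _ _ _ lf Hr0) as [Hge Hgt].
{ unfold scaled_rho. rewrite <- (flow_clock_0 m) by assumption.
  rewrite flow_time_flow_clock by lra.
  replace (rho 0) with 0 by (symmetry; apply Hrho). lra. }
{ intros s s' Hs _. now apply (scaled_rho_monotone k). }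
{ intros e He. apply (scaled_rho_growth k); try assumption; lra. }
assert (HF : forall r t, 0 < r <= r0 -> 0 <= t < T ->
  gaussK a b r t + / xi m t = - (flowGs m a r (flow_clock m t) / xi m t)).
{ intros r t Hr Ht. destruct Hsol as (_ & Ha & _ & _ & Hpde & _).
  destruct (Hpde r t Hr Ht) as [E _]. specialize (Ha r t ltac:(lra) Ht).
  assert (Hxi := xi_pos m t Hm ltac:(lra)).
  unfold flowGs. rewrite flow_time_flow_clock by lra. rewrite E. field. lra. }
assert (Hst : forall t, 0 <= t < T -> ln m / 2 <= flow_clock m t < flow_clock m T).
{ intros t Ht. split; [|apply flow_clock_lt; lra]. rewrite <- flow_clock_0 by assumption.
  destruct (Req_dec t 0) as [->|]; [lra|left; apply flow_clock_lt; lra]. }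
assert (Hweak : forall r t, 0 < r <= r0 -> 0 <= t < T -> gaussK a b r t + / xi m t <= 0).
{ intros r t Hr Ht. rewrite HF by assumption.
  assert (Hxi := xi_pos m t Hm ltac:(lra)).
  assert (0 <= flowGs m a r (flow_clock m t) / xi m t); [|lra].
  apply Rdiv_le_0_compat; [|lra]. apply Hge; [lra|now apply Hst]. }
(* A strict inequality at each [r] could degenerate as [r -> 0]; a gap [mu] independent of [r]
   passes to the limit. *)
assert (Hstrict : forall t, 0 < t < T -> exists mu, 0 < mu /\
  forall r, 0 < r <= r0 -> gaussK a b r t + / xi m t <= - mu).
{ intros t Ht. assert (Hxi := xi_pos m t Hm ltac:(lra)).
  destruct (Hgt (flow_clock m t)) as (mu & Hmu & Hle).
  { split; [|apply flow_clock_lt; lra]. rewrite <- flow_clock_0 by assumption.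
    apply flow_clock_lt; lra. }
  exists (mu / xi m t). split; [now apply Rdiv_lt_0_compat|]. intros r Hr.
  rewrite HF by lra. apply Ropp_le_contravar.
  apply Rmult_le_compat_r; [left; now apply Rinv_0_lt_compat|]. apply Hle; lra. }
assert (Hlim : forall t K0 c,
  filterlim (fun r => gaussK a b r t) (at_right 0) (locally K0) ->
  (forall r, 0 < r <= r0 -> gaussK a b r t + / xi m t <= c) -> K0 + / xi m t <= c).
{ intros t K0 c HK Hc. enough (K0 <= c - / xi m t) by lra.
  apply (filterlim_le (F := at_right 0) (fun r => gaussK a b r t) (fun _ => c - / xi m t)
    (Finite K0) (Finite (c - / xi m t))).
  - exists (mkposreal r0 Hr0). intros r Hr Hpos. change (Rabs (r - 0) < r0) in Hr.
    apply Rabs_def2 in Hr. specialize (Hc r ltac:(lra)). lra.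
  - exact HK.
  - apply filterlim_const. }
split.
- intros r t Hr Ht. split; [now apply Hweak|]. intros Hpos.
  destruct (Hstrict t ltac:(lra)) as (mu & Hmu & Hle). specialize (Hle r Hr). lra.
- intros t K0 Ht HK. split.
  + apply (Hlim t K0 0 HK). intros r Hr. now apply Hweak.
  + intros Hpos. destruct (Hstrict t ltac:(lra)) as (mu & Hmu & Hle).
    specialize (Hlim t K0 (- mu) HK Hle). lra.
Qed.
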